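(* Let $p\neq 2$ be a prime and let $$G=Z_{p^{\lambda_1}}\times Z_{p^{\lambda_2}}\times \cdots \times Z_{p^{\lambda_n}},\quad 0<\lambda_1<\lambda_2<\cdots<\lambda_n,$$ $$H=Z_{p^{\mu_1}}\times Z_{p^{\mu_2}}\times \cdots \times Z_{p^{\mu_m}},\quad 0<\mu_1<\mu_2<\cdots<\mu_m,\quad m\le n.$$ Then the lattices of characteristic subgroups of $G$ and $H$ are isomorphic if and only if one of the following holds: (i) $G=H$ (i.e. $m=n$ and $\lambda_i=\mu_i$ for all $i$); (ii) $G=Z_{p^k}\times Z_{p^{k+1}}$ and $H=Z_{p^{2k+1}}$ for some integer $k\ge 1$; (iii) $G=Z_p\times Z_{p^2}\times Z_{p^4}$ and $H=Z_{p^2}\times Z_{p^5}$.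
   Context: $Z_{p^a}$ denotes the cyclic group of order $p^a$. For a group $G$, the lattice of characteristic subgroups of $G$ (ordered by inclusion, with intersection as meet and the generated subgroup as join) is denoted $\mathrm{Char}(G)$. *)

(* Defs.v *)
From mathcomp Require Import all_boot all_fingroup all_solvable.
Set Implicit Arguments. Unset Strict Implicit. Unset Printing Implicit Defensive.
Local Open Scope group_scope.

Definition cyc_pprod (gT : finGroupType) (G : {group gT}) (p n : nat)
    (lam : nat -> nat) : Prop :=
  exists x : 'I_n -> gT,
    (forall i : 'I_n, #[x i] = p ^ lam i)%N /\
    \big[dprod/1]_(i < n) <[x i]> = G.

Definition charLat (gT : finGroupType) (G : {group gT}) : {set {group gT}} :=
  [set K : {group gT} | K \char G].

Definition char_lattice_iso (gT rT : finGroupType) (G : {group gT})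
    (H : {group rT}) : Prop :=
  exists f : {group gT} -> {group rT},
    [/\ {in charLat G &, injective f},
        f @: charLat G = charLat H,
        {in charLat G &, forall A B : {group gT}, f (A :&: B)%G :=: f A :&: f B} &
        {in charLat G &, forall A B : {group gT}, f (A <*> B)%G :=: f A <*> f B}].

(* Main.v *)
Require Import Defs.
From mathcomp Require Import all_boot all_fingroup all_solvable.
From mathcomp Require Import zify.
Set Implicit Arguments.
Unset Strict Implicit.
Unset Printing Implicit Defensive.

(* For odd p the characteristic subgroups of G are the products of the subgroups of order p^(a_i) of the cyclic factors, where a_i and lam_i - a_i are both nondecreasing in i. These tuples form a distributive lattice. Its join-irreducibles are the pairs (x, y) of positive integers with x + y = lam_i + 1 for some i, ordered by x increasing and y decreasing.

Unless this poset is a chain, the set of points that are incomparable to some other point has exactly two minimal elements: the second point of the longest row and the first point of some shorter row. An isomorphism of posets either respects the two or exchanges them. In the first case it fixes the first point of each row, and the numbers of points that are not above these recover the lam_i. In the second case it maps the first points of the rows into the longest row (or the two longest, if their lengths differ by one) of the other poset; comparing the same numbers leaves finitely many possibilities for the gaps lam_(i+1) - lam_i. *)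

(** * Characteristic subgroups as tuples *)

(** The last inequality says that [lam i - a i] is nondecreasing, with sums in place of truncated
    subtraction. Values of [a] from index [n] on carry no information, so tuples are compared only
    below [n]. *)
Definition canonical n (lam a : nat -> nat) : Prop :=
  (forall i, i < n -> a i <= lam i) /\
  (forall i j, i < j -> j < n -> a i <= a j /\ a j + lam i <= a i + lam j).

Definition le_upto n (a b : nat -> nat) : bool := all (fun i => a i <= b i) (iota 0 n).

Lemma le_uptoP n a b : reflect (forall i, i < n -> a i <= b i) (le_upto n a b).
Proof.
apply: (iffP allP) => [le_ab i lt_in | le_ab i].
  by apply: le_ab; rewrite mem_iota.
by rewrite mem_iota => lt_in; apply: le_ab.
Qed.

Section CyclicProductCharacteristic.

Local Open Scope group_scope.

Lemma bigdprod_cycle_abelian (gT : finGroupType) (I : Type) (r : seq I)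
    (x : I -> gT) (G : {group gT}) :
  \big[dprod/1]_(i <- r) <[x i]> = G -> abelian G.
Proof.
elim: r G => [|i r IHr] G; first by rewrite big_nil => <-; apply: abelian1.
rewrite big_cons => defG; have [[_ H _ defH] <- cH _] := dprodP defG.
by rewrite defH abelianM cycle_abelian (IHr _ defH) -defH.
Qed.

Lemma prod_expgD (gT : finGroupType) (I : Type) (r : seq I) (x : I -> gT)
    (G : {group gT}) (c d : I -> nat) :
  abelian G -> (forall i, x i \in G) ->
  \prod_(i <- r) x i ^+ c i * \prod_(i <- r) x i ^+ d i
    = \prod_(i <- r) x i ^+ (c i + d i).
Proof.
move=> abG Gx; elim: r => [|i r IHr]; first by rewrite !big_nil mulg1.
rewrite !big_cons -IHr expgD -!mulgA; congr (_ * _); rewrite !mulgA; congr (_ * _).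
by apply: (centsP abG); rewrite ?group_prod // => *; rewrite groupX.
Qed.

(** The [co g i] are chosen exponents. Uniqueness in the direct product determines them only modulo
    [#[x i]], so coordinates are handled through congruences. *)
Lemma cyclic_coordinates (gT : finGroupType) (n : nat) (x : 'I_n -> gT)
    (G : {group gT}) :
  \big[dprod/1]_(i < n) <[x i]> = G ->
  exists co : gT -> 'I_n -> nat,
    (forall g, g \in G -> \prod_(i < n) x i ^+ co g i = g) /\
    (forall c i, co (\prod_(i < n) x i ^+ c i) i = c i %[mod #[x i]]).
Proof.
move=> defG.
have /fin_all_exists[co coK] : forall g : gT, exists c : 'I_n -> nat,
    g \in G -> \prod_(i < n) x i ^+ c i = g.
  move=> g; have [Gg | _] := boolP (g \in G); last by exists (fun=> 0%N).
  have [c [xc -> _]] := mem_bigdprod defG Gg.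
  have /fin_all_exists[d cd] : forall i, exists k, c i = x i ^+ k.
    by move=> i; apply/cycleP; apply: xc.
  by exists d => _; apply: eq_bigr => i _; rewrite cd.
have Gx i : x i \in G.
  by rewrite -cycle_subG -(bigdprodWY defG) sub_gen // (bigcup_sup i).
exists co; split=> // c i.
set g := \prod_(j < n) _; have Gg : g \in G by rewrite group_prod // => j _; rewrite groupX.
have [e [_ _ uniq_e]] := mem_bigdprod defG Gg.
apply/eqP; rewrite -eq_expg_mod_order.
rewrite (uniq_e (fun j => x j ^+ co g j)) //; last 2 first.
- by move=> j _; apply: mem_cycle.
- by rewrite coK.
by rewrite (uniq_e (fun j => x j ^+ c j)) // => j _; apply: mem_cycle.
Qed.

Variables (gT : finGroupType) (G : {group gT}) (p n : nat) (lam : nat -> nat).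
Variables (x : 'I_n -> gT) (co : gT -> 'I_n -> nat).
Hypotheses (p_pr : prime p) (p_odd : p != 2%N).
Hypothesis lam_gt0 : forall i, (i < n)%N -> (0 < lam i)%N.
Hypothesis lam_incr : forall i j, (i < j < n)%N -> (lam i < lam j)%N.
Hypothesis ox : forall i, #[x i] = (p ^ lam i)%N.
Hypothesis abG : abelian G.
Hypothesis Gx : forall i, x i \in G.
Hypothesis coK : forall g, g \in G -> \prod_(i < n) x i ^+ co g i = g.
Hypothesis prodK : forall c i,
  co (\prod_(i < n) x i ^+ c i) i = c i %[mod p ^ lam i].

Lemma coM g h i : g \in G -> h \in G ->
  co (g * h) i = co g i + co h i %[mod p ^ lam i].
Proof.
move=> Gg Gh; rewrite -{1}(coK Gg) -{1}(coK Gh) (prod_expgD _ _ _ abG Gx).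
exact: (prodK (fun i => co g i + co h i)%N).
Qed.

Lemma co1 i : co 1 i = 0 %[mod p ^ lam i].
Proof.
rewrite -[X in co X](_ : \prod_(j < n) x j ^+ 0 = 1); first exact: (prodK (fun=> 0%N)).
by rewrite big1.
Qed.

Lemma coX g k i : g \in G -> co (g ^+ k) i = k * co g i %[mod p ^ lam i].
Proof.
move=> Gg; elim: k => [|k IHk]; first by rewrite expg0 co1.
by rewrite expgS coM ?groupX // -modnDmr IHk modnDmr mulSn.
Qed.

Lemma co_gen i j : co (x i) j = (i == j) %[mod p ^ lam j].
Proof.
rewrite -[X in co X](_ : \prod_(k < n) x k ^+ (i == k) = x i).
  exact: (prodK (fun k => i == k : nat)).
rewrite (eq_bigr (fun k => if k == i then x k else 1)) => [|k _].
  by rewrite -big_mkcond big_pred1_eq.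
by rewrite eq_sym; case: eqP.
Qed.

(* Applied to the automorphism g |-> g * y ^+ co g i of G. *)
Lemma char_shear (K : {group gT}) (i : 'I_n) y g :
  y \in G -> y ^+ (p ^ lam i) = 1 -> coprime p (1 + co y i) ->
  K \char G -> g \in K -> y ^+ co g i \in K.
Proof.
move=> Gy yq cop chK Kg; have sKG := char_sub chK.
pose f h := h * y ^+ co h i.
have eq_y k l : k = l %[mod p ^ lam i] -> y ^+ k = y ^+ l.
  move=> eq_kl; apply/eqP; rewrite eq_expg_mod_order.
  have: #[y] %| p ^ lam i by rewrite order_dvdn yq.
  by move=> dvd; rewrite -(modn_dvdm k dvd) eq_kl modn_dvdm.
have fM : {in G &, {morph f : a b / a * b}}.
  move=> a b Ga Gb; rewrite /f (eq_y _ _ (coM i Ga Gb)) expgD !mulgA; congr (_ * _).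
  rewrite -!mulgA; congr (_ * _).
  by apply: (centsP abG); rewrite ?groupX.
have inj_f : 'injm (Morphism fM).
  apply/subsetP => a /morphpreP[Ga /set1P/= fa1]; apply/set1P.
  (* If [f a = 1], this product vanishes modulo [p ^ lam i]. As [1 + co y i] is prime to [p], so
     does [co a i]; the factor contributed by [y] is then trivial and [a = f a = 1]. *)
  have : co (f a) i = co a i * (1 + co y i) %[mod p ^ lam i].
    by rewrite coM ?groupX // -modnDmr coX // modnDmr mulnDr muln1.
  rewrite fa1 co1 mod0n => /esym/eqP; rewrite -/(dvdn _ _).
  rewrite Gauss_dvdl ?coprimeXl // => dvd_a.
  move: fa1; rewrite /f (eq_y _ 0%N) ?expg0 ?mulg1 //.
  by rewrite mod0n; apply/eqP.
have imG : Morphism fM @* G = G.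
  apply/eqP; rewrite eqEcard card_injm // leqnn andbT.
  by apply/subsetP => _ /morphimP[a Ga _ ->] /=; rewrite groupM ?groupX.
have [_ /(_ _ inj_f imG) imK] := charP _ _ chK.
have : Morphism fM g \in K by rewrite -imK mem_morphim ?(subsetP sKG).
by rewrite /= /f groupMl.
Qed.

(** When the search fails, [find] returns [lam i], which is the right value because
    [x i ^+ (p ^ lam i) = 1]. *)
Definition gen_val (K : {group gT}) (i : 'I_n) : nat :=
  find (fun s => x i ^+ (p ^ s) \in K) (iota 0 (lam i)).

Lemma gen_val_le (K : {group gT}) i : gen_val K i <= lam i.
Proof. by rewrite -[leqRHS](size_iota 0) find_size. Qed.

(** By Bezout, [k] may be replaced by its gcd with the order [p ^ lam i]. This gcd is a power of
    [p], to which the minimality of [gen_val] applies. *)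
Lemma gen_valP (K : {group gT}) i k : (x i ^+ k \in K) = (p ^ gen_val K i %| k).
Proof.
have memv : x i ^+ (p ^ gen_val K i) \in K.
  case: (ltngtP (gen_val K i) (lam i)) (gen_val_le K i) => // [lt_v _ | -> _].
    have hasv : has (fun s => x i ^+ (p ^ s) \in K) (iota 0 (lam i)).
      by rewrite has_find size_iota.
    by have:= nth_find 0 hasv; rewrite nth_iota.
  by rewrite -ox expg_order group1.
apply/idP/idP => [Kxk | /dvdnP[l ->]]; last by rewrite mulnC expgM groupX.
have [s le_s gcd_s] : exists2 s, s <= lam i & gcdn k (p ^ lam i) = (p ^ s)%N.
  by apply/dvdn_pfactor; rewrite ?dvdn_gcdr.
have Kxs : x i ^+ (p ^ s) \in K.
  rewrite -gcd_s; case: (posnP k) => [-> | k_gt0].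
    by rewrite gcd0n -ox expg_order.
  have [u v def_g _] := egcdnP (p ^ lam i) k_gt0.
  have : x i ^+ (u * k) \in K by rewrite mulnC expgM groupX.
  by rewrite def_g expgD mulnC expgM -ox expg_order expg1n mul1g.
have le_vs : gen_val K i <= s.
  rewrite leqNgt; apply/negP => lt_sv.
  have lt_sl := leq_trans lt_sv (gen_val_le K i).
  by have:= before_find 0 lt_sv; rewrite nth_iota //= add0n Kxs.
apply: dvdn_trans (dvdn_gcdl k (p ^ lam i)).
by rewrite gcd_s dvdn_exp2l.
Qed.

Lemma coprime_1D_mod (i : 'I_n) k l : k = l %[mod p ^ lam i] ->
  coprime p (1 + k) = coprime p (1 + l).
Proof.
move=> eq_kl; have dvd : p %| p ^ lam i by rewrite dvdn_exp // lam_gt0.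
by rewrite -coprime_modr -modnDmr -(modn_dvdm k dvd) eq_kl modn_dvdm // modnDmr coprime_modr.
Qed.

(** The shear with [y = x i] puts each component [x i ^+ co g i] into [K], so [K] is the product of
    its intersections with the cyclic factors. This shear multiplies coordinate [i] by [1 + 1 = 2],
    a unit modulo [p] because [p] is odd. *)
Lemma mem_char_coord (K : {group gT}) g : K \char G -> g \in G ->
  (g \in K) = [forall i, p ^ gen_val K i %| co g i].
Proof.
move=> chK Gg; apply/idP/forallP => [Kg i | dvd_g].
  rewrite -gen_valP; apply: (char_shear (i := i)) => //.
    by rewrite -ox expg_order.
  rewrite (coprime_1D_mod (co_gen i i)) eqxx.
  by rewrite prime_coprime // gtnNdvd // ltn_neqAle eq_sym p_odd prime_gt1.
rewrite -(coK Gg) group_prod // => i _.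
by rewrite gen_valP.
Qed.

(** For [a i <= lam i] the divisibility says that component [i] lies in the subgroup of order
    [p ^ a i] of [<[x i]>]. *)
Definition coord_group_set (a : nat -> nat) : {set gT} :=
  [set g in G | [forall i : 'I_n, p ^ (lam i - a i) %| co g i]].

Lemma dvdn_co_mod m i k l : m <= lam i -> k = l %[mod p ^ lam i] ->
  (p ^ m %| k) = (p ^ m %| l).
Proof.
move=> le_m eq_kl; have dvd := dvdn_exp2l p le_m.
by rewrite /dvdn -(modn_dvdm k dvd) eq_kl modn_dvdm.
Qed.

Lemma coord_groupP a : group_set (coord_group_set a).
Proof.
apply/group_setP; split=> [|g h].
  rewrite inE group1; apply/forallP => i.
  by rewrite (dvdn_co_mod (l := 0) (i := i)) ?leq_subr ?co1 // dvdn0.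
rewrite !inE => /andP[Gg /forallP dvd_g] /andP[Gh /forallP dvd_h].
rewrite groupM //=; apply/forallP => i.
rewrite (dvdn_co_mod (l := co g i + co h i) (i := i)) ?leq_subr ?coM //.
by rewrite dvdn_add.
Qed.

Definition coord_group a := Group (coord_groupP a).

Lemma gen_val_coord_group a i : gen_val (coord_group a) i = (lam i - a i)%N.
Proof.
have memx k : (x i ^+ k \in coord_group a) = (p ^ (lam i - a i) %| k).
  rewrite inE groupX //=; apply/forallP/idP => [/(_ i) | dvd_k j].
    rewrite (dvdn_co_mod (l := k) (i := i)) ?leq_subr // coX //.
    by rewrite -modnMmr co_gen eqxx modnMmr muln1.
  rewrite (dvdn_co_mod (l := k * (i == j)) (i := j)) ?leq_subr //; last first.
    by rewrite coX // -modnMmr co_gen modnMmr.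
  by case: eqP => [<- | _]; rewrite ?muln1 ?muln0 ?dvdn0.
have p_gt1 := prime_gt1 p_pr.
apply/eqP; rewrite eqn_leq -!(dvdn_Pexp2l _ _ p_gt1).
by rewrite -gen_valP memx dvdnn -memx gen_valP dvdnn.
Qed.

(** An automorphism sends [x i] to an element killed by [p ^ lam i]. For [i < j] its coordinate [j]
    is therefore divisible by [p ^ (lam j - lam i)], and [a i <= a j] suffices. For [j < i] it
    suffices that [lam - a] is nondecreasing. *)
Lemma coord_group_char a : canonical n lam a -> coord_group a \char G.
Proof.
case=> le_al can_a; apply/charP; split=> [|f inj_f imG].
  by apply/subsetP => g; rewrite inE => /andP[].
have sAG : coord_group a \subset G by apply/subsetP => g; rewrite inE => /andP[].
apply/eqP; rewrite eqEcard card_injm // leqnn andbT.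
apply/subsetP => _ /morphimP[g Gg Ag ->].
rewrite -(coK Gg) morph_prod; last by move=> i _; rewrite groupX.
rewrite group_prod // => i _; rewrite morphX //.
have Gfx : f (x i) \in G.
  have : f (x i) \in f @* G by rewrite mem_morphim.
  by rewrite imG.
rewrite inE groupX //; apply/forallP => j.
rewrite (dvdn_co_mod (l := co g i * co (f (x i)) j) (i := j)) ?leq_subr ?coX //.
move: Ag; rewrite inE => /andP[_ /forallP/(_ i)] dvd_g.
have le_j := le_al j (ltn_ord j); have le_i := le_al i (ltn_ord i).
have : p ^ lam j %| p ^ lam i * co (f (x i)) j.
  rewrite (dvdn_co_mod (l := co (f (x i) ^+ (p ^ lam i)) j) (i := j)) ?coX //.
  by rewrite -morphX // -(ox i) expg_order morph1 (dvdn_co_mod (l := 0) (i := j)) ?co1.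
case: (ltngtP i j) => [lt_ij | lt_ji | /val_inj eq_ij].
- have lt_lam : lam i < lam j by apply: lam_incr; rewrite lt_ij ltn_ord.
  have [le_a _] := can_a _ _ lt_ij (ltn_ord j).
  have -> : lam j = (lam i + (lam j - lam i))%N by lia.
  rewrite expnD dvdn_pmul2l ?expn_gt0 ?prime_gt0 // => dvd_f.
  apply: dvdn_trans (dvdn_mul dvd_g dvd_f).
  by rewrite -expnD dvdn_exp2l //; lia.
- move=> _; have [le_a le_a'] := can_a _ _ lt_ji (ltn_ord i).
  by apply/dvdn_mulr/(dvdn_trans _ dvd_g); rewrite dvdn_exp2l //; lia.
- by move=> _; rewrite -eq_ij dvdn_mulr.
Qed.

Definition coord_fun (K : {group gT}) (j : nat) : nat :=
  if insub j is Some i then (lam j - gen_val K i)%N else 0%N.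

Lemma coord_fun_ord (K : {group gT}) (i : 'I_n) : coord_fun K i = (lam i - gen_val K i)%N.
Proof. by rewrite /coord_fun valK. Qed.

(** For [i < j] two shears are used: [x i] maps to [x i * x j ^+ (p ^ (lam j - lam i))], and [x j]
    maps to [x j * x i]. With [v = gen_val K] they give [v j <= lam j - lam i + v i] and
    [v i <= v j], which are the two conditions on [lam - v]. *)
Lemma coord_fun_canonical (K : {group gT}) : K \char G -> canonical n lam (coord_fun K).
Proof.
move=> chK; split=> [i lt_in | i j lt_ij lt_jn].
  by rewrite (coord_fun_ord K (Ordinal lt_in)) leq_subr.
have lt_in := ltn_trans lt_ij lt_jn.
have lt_lam : lam i < lam j by apply: lam_incr; rewrite lt_ij.
rewrite (coord_fun_ord K (Ordinal lt_in)) (coord_fun_ord K (Ordinal lt_jn)) /=.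
set i' := Ordinal lt_in; set j' := Ordinal lt_jn.
have p_gt1 := prime_gt1 p_pr.
have neq_ij : (i' == j') = false by rewrite -val_eqE /= ltn_eqF.
have neq_ji : (j' == i') = false by rewrite eq_sym.
have cop_co y k : co y k = 0 %[mod p ^ lam k] -> coprime p (1 + co y k).
  by move=> co0; rewrite (coprime_1D_mod co0) coprimen1.
have v_mem k : x k ^+ (p ^ gen_val K k) \in K by rewrite gen_valP.
have shear (k : 'I_n) y : y \in G -> y ^+ (p ^ lam k) = 1 -> co y k = 0 %[mod p ^ lam k] ->
    y ^+ (p ^ gen_val K k) \in K.
  move=> Gy yq co0; have := char_shear Gy yq (cop_co _ _ co0) chK (v_mem k).
  congr (_ \in K); apply/eqP; rewrite eq_expg_mod_order.
  have dvd: #[y] %| p ^ lam k by rewrite order_dvdn yq.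
  rewrite -(modn_dvdm _ dvd) coX // -modnMmr co_gen eqxx modnMmr muln1.
  by rewrite modn_dvdm.
have := gen_val_le K i'; have := gen_val_le K j'; rewrite /= => le_j le_i.
have : gen_val K j' <= lam j - lam i + gen_val K i'.
  rewrite -(dvdn_Pexp2l _ _ p_gt1) expnD -gen_valP expgM.
  apply: shear; first by rewrite groupX.
    by rewrite -expgM -expnD subnK ?(ltnW lt_lam) // -(ox j') expg_order.
  by rewrite coX // -modnMmr co_gen neq_ji modnMmr muln0.
have : gen_val K i' <= gen_val K j'.
  rewrite -(dvdn_Pexp2l _ _ p_gt1) -gen_valP; apply: shear => //=.
    by rewrite -(subnK (ltnW lt_lam)) addnC expnD expgM -(ox i') expg_order expg1n.
  by rewrite co_gen neq_ij.
by split; lia.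
Qed.

Lemma coord_funK (K : {group gT}) : K \char G -> coord_group (coord_fun K) = K.
Proof.
move=> chK; apply/val_inj/setP => g; rewrite /= inE.
have [Gg | nGg] := boolP (g \in G).
  rewrite (mem_char_coord chK Gg); apply: eq_forallb => i.
  by rewrite coord_fun_ord subKn ?gen_val_le.
by apply/esym/(contraNF _ nGg)/subsetP/(char_sub chK).
Qed.

Lemma coord_groupK a i : canonical n lam a -> i < n ->
  coord_fun (coord_group a) i = a i.
Proof.
case=> le_al _ lt_in; rewrite (coord_fun_ord _ (Ordinal lt_in)) gen_val_coord_group /=.
by rewrite subKn ?le_al.
Qed.

Lemma coord_fun_sub (K K' : {group gT}) : K \char G -> K' \char G ->
  (K \subset K') = le_upto n (coord_fun K) (coord_fun K').
Proof.
move=> chK chK'; apply/subsetP/le_uptoP => [sKK' i lt_in | le_KK' g Kg].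
  rewrite !(coord_fun_ord _ (Ordinal lt_in)) leq_sub2l //.
  rewrite -(dvdn_Pexp2l _ _ (prime_gt1 p_pr)) -gen_valP sKK' //.
  by rewrite gen_valP.
have Gg := subsetP (char_sub chK) _ Kg.
rewrite (mem_char_coord chK' Gg); apply/forallP => i.
move: Kg; rewrite (mem_char_coord chK Gg) => /forallP/(_ i); apply: dvdn_trans.
rewrite dvdn_exp2l //; have := le_KK' i (ltn_ord i); rewrite !coord_fun_ord.
by have := gen_val_le K i; have := gen_val_le K' i; lia.
Qed.

End CyclicProductCharacteristic.

Lemma charLat_coordinates (gT : finGroupType) (G : {group gT}) (p n : nat)
    (lam : nat -> nat) :
  prime p -> p != 2 ->
  (forall i, i < n -> 0 < lam i) -> (forall i j, i < j < n -> lam i < lam j) ->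
  cyc_pprod G p n lam ->
  exists (enc : (nat -> nat) -> {group gT}) (dec : {group gT} -> nat -> nat),
    [/\ forall K, K \in charLat G -> canonical n lam (dec K) /\ enc (dec K) = K,
        forall a, canonical n lam a -> enc a \in charLat G,
        forall a, canonical n lam a -> forall i, i < n -> dec (enc a) i = a i &
        forall K K', K \in charLat G -> K' \in charLat G ->
          (K \subset K') = le_upto n (dec K) (dec K')].
Proof.
move=> p_pr p_odd lam_gt0 lam_incr [x [ox defG]].
have abG := bigdprod_cycle_abelian defG.
have Gx i : x i \in G.
  by rewrite -cycle_subG -(bigdprodWY defG) sub_gen // (bigcup_sup i).
have [co [coK prodK0]] := cyclic_coordinates defG.
have prodK c i : co (\prod_(i < n) x i ^+ c i)%g i = c i %[mod p ^ lam i].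
  by rewrite -ox prodK0.
exists (coord_group abG Gx coK prodK), (coord_fun p lam x).
split=> [K | a can_a | a can_a i lt_in | K K']; rewrite ?inE.
- move=> chK; split; last exact: coord_funK.
  by apply: (coord_fun_canonical (G := G) (co := co)).
- exact: coord_group_char.
- exact: coord_groupK.
- by move=> chK chK'; apply: (coord_fun_sub (G := G) (co := co)).
Qed.

(** * Join-irreducibles *)

(** Preserving and reflecting the order includes injectivity; surjectivity is asked only up to
    agreement below [m]. *)
Definition canonical_iso n (lam : nat -> nat) m (mu : nat -> nat) : Prop :=
  exists phi : (nat -> nat) -> nat -> nat,
    [/\ forall a, canonical n lam a -> canonical m mu (phi a),
        forall a b, canonical n lam a -> canonical n lam b ->
          le_upto m (phi a) (phi b) = le_upto n a b &
        forall b, canonical m mu b -> exists2 a, canonical n lam a &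
          forall i, i < m -> phi a i = b i].

Lemma le_upto_ext n a a' b b' :
  (forall i, i < n -> a i = a' i) -> (forall i, i < n -> b i = b' i) ->
  le_upto n a b = le_upto n a' b'.
Proof.
by move=> eq_a eq_b; apply: eq_in_all => i; rewrite mem_iota => lt_in; rewrite eq_a ?eq_b.
Qed.

Lemma le_upto_anti n a b : le_upto n a b -> le_upto n b a ->
  forall i, i < n -> a i = b i.
Proof.
move=> /le_uptoP le_ab /le_uptoP le_ba i lt_in.
by apply/eqP; rewrite eqn_leq le_ab ?le_ba.
Qed.

Lemma le_upto_refl n a : le_upto n a a.
Proof. exact/le_uptoP. Qed.

Lemma charLat_iso_sub (gT rT : finGroupType) (G : {group gT}) (f : {group gT} -> {group rT}) :
  {in charLat G &, injective f} ->
  {in charLat G &, forall A B : {group gT}, f (A :&: B)%G :=: f A :&: f B}%g ->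
  {in charLat G &, forall A B : {group gT}, (f A \subset f B) = (A \subset B)}.
Proof.
move=> inj_f fI A B cA cB.
have cAB : (A :&: B)%G \in charLat G by move: cA cB; rewrite !inE; apply: charI.
apply/idP/idP => [/setIidPl | /setIidPl eqA].
  rewrite -fI // => /val_inj/(inj_f _ _ cAB cA) eqA.
  by apply/setIidPl; rewrite -[in RHS]eqA.
apply/setIidPl; rewrite -fI //; congr (gval (f _)); exact: val_inj.
Qed.

(** A bijection that preserves and reflects inclusion respects meets and joins: the preimage of
    [f A :&: f B] lies in both [A] and [B], hence in [A :&: B], and dually for joins. Conversely,
    inclusion is recovered from meets. *)
Lemma char_lattice_iso_canonical (gT rT : finGroupType) (G : {group gT})
    (H : {group rT}) (p n m : nat) (lam mu : nat -> nat) :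
  prime p -> p != 2 ->
  (forall i, i < n -> 0 < lam i) -> (forall i j, i < j < n -> lam i < lam j) ->
  (forall i, i < m -> 0 < mu i) -> (forall i j, i < j < m -> mu i < mu j) ->
  cyc_pprod G p n lam -> cyc_pprod H p m mu ->
  char_lattice_iso G H <-> canonical_iso n lam m mu.
Proof.
move=> p_pr p_odd lam_gt0 lam_incr mu_gt0 mu_incr prodG prodH.
have [encG [decG [canG chG encGK subG]]] :=
  charLat_coordinates p_pr p_odd lam_gt0 lam_incr prodG.
have [encH [decH [canH chH encHK subH]]] :=
  charLat_coordinates p_pr p_odd mu_gt0 mu_incr prodH.
split=> [[f [inj_f imf fI fY]] | [phi [can_phi le_phi onto_phi]]].
  have fP K : K \in charLat G -> f K \in charLat H.
    by move=> cK; rewrite -imf imset_f.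
  exists (fun a => decH (f (encG a))); split=> [a can_a | a b can_a can_b | b can_b].
  - by have [] := canH _ (fP _ (chG _ can_a)).
  - rewrite -subH ?fP ?chG // (charLat_iso_sub inj_f fI) ?chG // subG ?chG //.
    by apply: le_upto_ext; apply: encGK.
  - have: encH b \in f @: charLat G by rewrite imf chH.
    case/imsetP=> K cK fK; exists (decG K); first by have [] := canG _ cK.
    have [_ ->] := canG _ cK.
    by rewrite -fK; apply: encHK.
have charLatI (rT' : finGroupType) (L A B : {group rT'}) :
  A \in charLat L -> B \in charLat L -> (A :&: B)%G \in charLat L.
  by rewrite !inE; apply: charI.
have charLatY (rT' : finGroupType) (L A B : {group rT'}) :
  A \in charLat L -> B \in charLat L -> (A <*> B)%G \in charLat L.
  by rewrite !inE; apply: charY.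
pose f K := encH (phi (decG K)).
have can_d K : K \in charLat G -> canonical n lam (decG K) by case/canG.
have fP K : K \in charLat G -> f K \in charLat H by move=> cK; apply/chH/can_phi/can_d.
have fS : {in charLat G &, forall A B : {group gT}, (f A \subset f B) = (A \subset B)}.
  move=> A B cA cB; rewrite subH ?fP // subG // -le_phi; try exact: can_d.
  by apply: le_upto_ext; apply/encHK/can_phi/can_d.
have f_onto L : L \in charLat H -> exists2 K, K \in charLat G & f K = L.
  move=> cL; have [can_L decK] := canH _ cL; have [a can_a eq_a] := onto_phi _ can_L.
  have c_a := chG _ can_a; have [can_da _] := canG _ c_a.
  exists (encG a) => //.
  have eqd : forall i, i < m -> phi (decG (encG a)) i = decH L i.
    move=> i lt_im; rewrite -eq_a //.
    apply: (@le_upto_anti m) => //; rewrite le_phi //; apply/le_uptoP=> j lt_jn;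
      by rewrite encGK.
  apply/val_inj/eqP; rewrite eqEsubset !subH ?fP //.
  by apply/andP; split; apply/le_uptoP => i lt_im;
    rewrite /f encHK ?eqd //; apply: can_phi.
exists f; split.
- move=> A B cA cB eqf; apply/val_inj/eqP; rewrite eqEsubset -!fS //.
  by rewrite eqf subxx.
- apply/setP => L; apply/imsetP/idP => [[K cK ->] | /f_onto[K cK <-]]; first exact: fP.
  by exists K.
- move=> A B cA cB; apply/eqP; rewrite eqEsubset subsetI.
  have [C cC fC] := f_onto _ (charLatI _ _ _ _ (fP _ cA) (fP _ cB)).
  have fCE : f C = (f A :&: f B)%g :> {set rT} by rewrite fC.
  rewrite !fS ?charLatI // subsetIl subsetIr -fCE fS ?charLatI //= subsetI.
  by rewrite -(fS C A) // -(fS C B) // fCE subsetIl subsetIr.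
- move=> A B cA cB; apply/eqP; rewrite eqEsubset join_subG.
  have [C cC fC] := f_onto _ (charLatY _ _ _ _ (fP _ cA) (fP _ cB)).
  have fCE : f C = (f A <*> f B)%g :> {set rT} by rewrite fC.
  rewrite !fS ?charLatY // joing_subl joing_subr -fCE fS ?charLatY //= join_subG.
  by rewrite -(fS A C) // -(fS B C) // fCE joing_subl joing_subr.
Qed.

(** The point [(i, x)] stands for the join-irreducible with parameters [x] and [lam i + 1 - x], that
    is, for the requirement that entry [i] be at least [x]. *)
Definition points n (lam : nat -> nat) : seq (nat * nat) :=
  [seq (i, x) | i <- iota 0 n, x <- iota 1 (lam i)].

Definition point_le (lam : nat -> nat) (q r : nat * nat) : bool :=
  (q.2 <= r.2) && (lam r.1 + q.2 <= lam q.1 + r.2).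

Definition points_iso n lam m mu (F E : nat * nat -> nat * nat) : Prop :=
  [/\ forall q, q \in points n lam -> F q \in points m mu /\ E (F q) = q,
      forall q, q \in points m mu -> E q \in points n lam /\ F (E q) = q &
      forall q r, q \in points n lam -> r \in points n lam ->
        point_le mu (F q) (F r) = point_le lam q r].

Lemma points_iso_sym n lam m mu F E :
  points_iso n lam m mu F E -> points_iso m mu n lam E F.
Proof.
case=> FP EP leF; split=> // q r /EP[Eq FEq] /EP[Er FEr].
by rewrite -leF // FEq FEr.
Qed.

Lemma mem_points n lam i x :
  ((i, x) \in points n lam) = [&& i < n, 0 < x & x <= lam i].
Proof.
apply/allpairsPdep/and3P => [[j [y [jn yl [-> ->]]]] | [lt_in x0 xl]].
  by move: jn yl; rewrite !mem_iota => jn yl; split; lia.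
by exists i, x; rewrite !mem_iota /=; split=> //; lia.
Qed.

Lemma points_uniq n lam : uniq (points n lam).
Proof.
apply: allpairs_uniq_dep; first exact: iota_uniq.
  by move=> i _; apply: iota_uniq.
by move=> [i x] [j y] _ _ /= [-> ->].
Qed.

(** The two counts are the numerical invariants by which images of points under an isomorphism are
    located. *)
Definition below n lam q := count (fun r => point_le lam r q) (points n lam).
Definition not_above n lam q := count (fun r => ~~ point_le lam q r) (points n lam).

Lemma count_points_iso n lam m mu F E (Q : pred (nat * nat)) :
  points_iso n lam m mu F E -> count (Q \o F) (points n lam) = count Q (points m mu).
Proof.
case=> FP EP _; rewrite -count_map; suff /seq.permP : perm_eq [seq F q | q <- points n lam] (points m mu) by [].
apply: uniq_perm.
- by rewrite map_inj_in_uniq ?points_uniq // => q r /FP[_ {2}<-] /FP[_ {2}<-] ->.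
- exact: points_uniq.
move=> q; apply/mapP/idP => [[r /FP[Fr _] ->] // | /EP[Eq FEq]].
by exists (E q).
Qed.

Lemma below_iso n lam m mu F E q : points_iso n lam m mu F E ->
  q \in points n lam -> below m mu (F q) = below n lam q.
Proof.
move=> isoF qP; rewrite /below -(count_points_iso _ isoF).
by case: isoF => _ _ leF; apply: eq_in_count => r rP /=; rewrite leF.
Qed.

Lemma not_above_iso n lam m mu F E q : points_iso n lam m mu F E ->
  q \in points n lam -> not_above m mu (F q) = not_above n lam q.
Proof.
move=> isoF qP; rewrite /not_above -(count_points_iso _ isoF).
by case: isoF => _ _ leF; apply: eq_in_count => r rP /=; rewrite leF.
Qed.

Lemma count_iota_le t k : count (fun x => x <= t) (iota 1 k) = minn t k.
Proof.
elim: k => [|k IHk]; first by rewrite minn0.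
by rewrite -[k.+1]addn1 iotaD count_cat IHk /=; case: leqP; lia.
Qed.

Lemma count_points n lam (Q : pred (nat * nat)) (t : nat -> nat) :
  (forall j x, j < n -> 0 < x -> x <= lam j -> Q (j, x) = (x <= t j)) ->
  count Q (points n lam) = \sum_(j < n) minn (t j) (lam j).
Proof.
move=> Qt; rewrite count_flatten -map_comp sumnE big_map -{1}[n]subn0 -/(index_iota 0 n).
rewrite big_mkord; apply: eq_bigr => j _ /=; rewrite count_map -count_iota_le.
apply: eq_in_count => x; rewrite mem_iota => /andP[x0 xl] /=.
by apply: Qt => //; lia.
Qed.

(** This is the least canonical tuple whose entry [q.1] is at least [q.2]; the subtraction truncates
    to zero in rows that are too short to be affected. *)
Definition point_tuple (lam : nat -> nat) (q : nat * nat) (j : nat) : nat :=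
  minn q.2 (lam j + q.2 - lam q.1).

(** In a finite distributive lattice these are the join-irreducibles. The partner [b], the greatest
    tuple not above [a], makes the notion purely order-theoretic, so isomorphisms transport it. *)
Definition completely_prime n lam a : Prop :=
  canonical n lam a /\
  exists2 b, canonical n lam b &
    forall c, canonical n lam c -> le_upto n a c = ~~ le_upto n c b.

Lemma lam_le n (lam : nat -> nat) : (forall i j, i < j < n -> lam i < lam j) ->
  forall i j, i <= j -> j < n -> lam i <= lam j.
Proof.
move=> lam_incr i j; rewrite leq_eqVlt => /predU1P[-> // | lt_ij] lt_jn.
by apply/ltnW/lam_incr; rewrite lt_ij.
Qed.

Lemma canonical_ge_point n lam c i x : (forall i j, i < j < n -> lam i < lam j) ->
  canonical n lam c -> i < n -> x <= c i -> le_upto n (point_tuple lam (i, x)) c.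
Proof.
move=> lam_incr [le_c can_c] lt_in le_x; apply/le_uptoP => j lt_jn.
rewrite /point_tuple /=; case: (ltngtP i j) => [lt_ij | lt_ji | <-].
- have [le_ij _] := can_c _ _ lt_ij lt_jn; lia.
- have [_ le_ji] := can_c _ _ lt_ji lt_in; lia.
- lia.
Qed.

Lemma point_tuple_canonical n lam q : (forall i j, i < j < n -> lam i < lam j) ->
  q \in points n lam -> canonical n lam (point_tuple lam q).
Proof.
case: q => i x lam_incr; rewrite mem_points => /and3P[lt_in x0 xl].
rewrite /point_tuple /=; split=> [j lt_jn | j k lt_jk lt_kn].
  lia.
have := lam_incr j k; rewrite lt_jk lt_kn => /(_ isT); lia.
Qed.

Lemma point_tuple_prime n lam q : (forall i j, i < j < n -> lam i < lam j) ->
  q \in points n lam -> completely_prime n lam (point_tuple lam q).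
Proof.
move=> lam_incr qP; split; first exact: point_tuple_canonical.
case: q qP => i x; rewrite mem_points => /and3P[lt_in x0 xl].
(* This is the greatest canonical tuple with entry [x - 1] at [i]; truncation makes it at most
   [x - 1] in the shorter rows. *)
exists (fun j => minn (lam j) (x.-1 + (lam j - lam i))).
  split=> [j lt_jn | j k lt_jk lt_kn]; first lia.
  have := lam_incr j k; rewrite lt_jk lt_kn => /(_ isT); lia.
move=> c can_c; have [le_c diff_c] := can_c.
have [le_x | lt_x] := leqP x (c i).
  rewrite canonical_ge_point //; apply/esym/negP => /le_uptoP/(_ i lt_in); lia.
rewrite (_ : le_upto n _ c = false); last first.
  by apply/negP => /le_uptoP/(_ i lt_in); rewrite /point_tuple /=; lia.
apply/esym/negbTE; rewrite negbK; apply/le_uptoP => j lt_jn.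
have := le_c j lt_jn; case: (ltngtP i j) => [lt_ij | lt_ji | <-].
- have [_ le_ij] := diff_c _ _ lt_ij lt_jn.
  have := lam_incr i j; rewrite lt_ij lt_jn => /(_ isT); lia.
- have [le_ij _] := diff_c _ _ lt_ji lt_in; lia.
- lia.
Qed.

(** As [a] is not below [b], some entry has [b i < a i]. The tuple of the point [(i, a i)] lies
    below [a] but not below [b], so by primality it also lies above [a]. *)
Lemma completely_prime_point n lam a : (forall i j, i < j < n -> lam i < lam j) ->
  completely_prime n lam a ->
  exists2 q, q \in points n lam & forall i, i < n -> a i = point_tuple lam q i.
Proof.
move=> lam_incr [can_a [b can_b prime_a]].
have : ~~ le_upto n a b by rewrite -prime_a ?le_upto_refl.
rewrite -has_predC => /hasP[i]; rewrite mem_iota /= -ltnNge => lt_in lt_ba.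
have qP : (i, a i) \in points n lam.
  by rewrite mem_points; have [/(_ i) le_a _] := can_a; move: le_a; lia.
exists (i, a i) => //; apply: le_upto_anti; last exact: canonical_ge_point.
rewrite prime_a; last exact: point_tuple_canonical.
by apply/negP => /le_uptoP/(_ i lt_in); rewrite /point_tuple /=; lia.
Qed.

Lemma point_tuple_le n lam q r : (forall i j, i < j < n -> lam i < lam j) ->
  q \in points n lam -> r \in points n lam ->
  le_upto n (point_tuple lam q) (point_tuple lam r) = point_le lam q r.
Proof.
case: q r => [i x] [j y] lam_incr; rewrite !mem_points.
move=> /and3P[lt_in x0 xl] /and3P[lt_jn y0 yl]; rewrite /point_le /=.
apply/le_uptoP/idP => [/(_ i lt_in) | le_xy k lt_kn]; rewrite /point_tuple /=; lia.
Qed.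

Lemma point_le_anti n lam : (forall i j, i < j < n -> lam i < lam j) ->
  forall q r, q \in points n lam -> r \in points n lam ->
  point_le lam q r -> point_le lam r q -> q = r.
Proof.
move=> lam_incr [i x] [j y]; rewrite !mem_points /point_le /=.
move=> /and3P[lt_in _ _] /and3P[lt_jn _ _] le_qr le_rq.
have eq_xy : x = y by lia.
have eq_lam : lam i = lam j by lia.
case: (ltngtP i j) => [lt_ij | lt_ji | ->]; last by rewrite eq_xy.
- by have := lam_incr i j; rewrite lt_ij lt_jn eq_lam ltnn => /(_ isT).
- by have := lam_incr j i; rewrite lt_ji lt_in eq_lam ltnn => /(_ isT).
Qed.

Lemma completely_prime_iso n lam m mu phi a :
  (forall a, canonical n lam a -> canonical m mu (phi a)) ->
  (forall a b, canonical n lam a -> canonical n lam b ->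
     le_upto m (phi a) (phi b) = le_upto n a b) ->
  (forall b, canonical m mu b -> exists2 a, canonical n lam a &
     forall i, i < m -> phi a i = b i) ->
  canonical n lam a -> completely_prime n lam a <-> completely_prime m mu (phi a).
Proof.
move=> can_phi le_phi onto_phi can_a; split=> [[_ [b can_b prime_a]] | [_ [b can_b prime_a]]].
  split; first exact: can_phi.
  exists (phi b) => [|c /onto_phi[d can_d eq_d]]; first exact: can_phi.
  rewrite -!(le_upto_ext (n := m) (a := phi a) (b := phi d) (b' := c)) //.
  rewrite -(le_upto_ext (n := m) (a := phi d) (a' := c) (b := phi b)) //.
  by rewrite !le_phi // prime_a.
have [d can_d eq_d] := onto_phi _ can_b.
split=> //; exists d => // c can_c; rewrite -!le_phi // prime_a; last exact: can_phi.
by congr (~~ _); apply: le_upto_ext => // i lt_im; rewrite eq_d.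
Qed.

Lemma canonical_iso_points n lam m mu :
  (forall i j, i < j < n -> lam i < lam j) -> (forall i j, i < j < m -> mu i < mu j) ->
  canonical_iso n lam m mu -> exists F E, points_iso n lam m mu F E.
Proof.
move=> lam_incr mu_incr [phi [can_phi le_phi onto_phi]].
have primeE := completely_prime_iso can_phi le_phi onto_phi.
(* [R q r] expresses that [phi] carries the tuple of [q] to that of [r], up to agreement below [m].
   [F] and [E] search for a partner; the default [(0, 0)] is never reached on actual points. *)
pose R q r := le_upto m (phi (point_tuple lam q)) (point_tuple mu r)
           && le_upto m (point_tuple mu r) (phi (point_tuple lam q)).
pose F q := nth (0, 0) (points m mu) (find (R q) (points m mu)).
pose E r := nth (0, 0) (points n lam) (find (R^~ r) (points n lam)).
have Fprop q : q \in points n lam -> F q \in points m mu /\ R q (F q).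
  move=> qP; have can_q := point_tuple_canonical lam_incr qP.
  have [r rP eq_r] := completely_prime_point mu_incr
    ((primeE _ can_q).1 (point_tuple_prime lam_incr qP)).
  have hasR : has (R q) (points m mu).
    apply/hasP; exists r => //.
    by apply/andP; split; apply/le_uptoP => i lt_im; rewrite eq_r.
  by rewrite /F mem_nth -?has_find ?nth_find.
have Eprop r : r \in points m mu -> E r \in points n lam /\ R (E r) r.
  move=> rP; have can_r := point_tuple_canonical mu_incr rP.
  have [a can_a eq_a] := onto_phi _ can_r.
  have prime_a : completely_prime n lam a.
    apply/primeE => //; have [_ [b can_b prime_r]] := point_tuple_prime mu_incr rP.
    split; first exact: can_phi.
    by exists b => // c can_c; rewrite -prime_r //; apply: le_upto_ext.
  have [q qP eq_q] := completely_prime_point lam_incr prime_a.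
  have hasR : has (R^~ r) (points n lam).
    apply/hasP; exists q => //.
    have can_q := point_tuple_canonical lam_incr qP.
    have eq_phi : forall i, i < m -> phi (point_tuple lam q) i = point_tuple mu r i.
      move=> i lt_im; rewrite -eq_a //; apply: (@le_upto_anti m) => //;
        by rewrite le_phi //; apply/le_uptoP => j lt_jn; rewrite eq_q.
    by apply/andP; split; apply/le_uptoP => i lt_im; rewrite eq_phi.
  by rewrite /E mem_nth -?has_find ?(nth_find _ hasR).
have leR q r q' r' : q \in points n lam -> q' \in points n lam ->
    r \in points m mu -> r' \in points m mu ->
    R q r -> R q' r' -> point_le mu r r' = point_le lam q q'.
  move=> qP q'P rP r'P /andP[qr rq] /andP[qr' rq'].
  rewrite -(point_tuple_le lam_incr) // -(point_tuple_le mu_incr) //.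
  rewrite -le_phi; try exact: point_tuple_canonical.
  by apply: le_upto_ext; apply: le_upto_anti.
exists F, E; split.
- move=> q qP; have [FqP Rq] := Fprop _ qP; have [EP REq] := Eprop _ FqP.
  split=> //; apply: (point_le_anti lam_incr) => //.
    by rewrite -(leR _ _ _ _ EP qP FqP FqP REq Rq) /point_le !leqnn.
  by rewrite -(leR _ _ _ _ qP EP FqP FqP Rq REq) /point_le !leqnn.
- move=> r rP; have [ErP RE] := Eprop _ rP; have [FP RF] := Fprop _ ErP.
  split=> //; apply: (point_le_anti mu_incr) => //.
    by rewrite (leR _ _ _ _ ErP ErP FP rP RF RE) /point_le !leqnn.
  by rewrite (leR _ _ _ _ ErP ErP rP FP RE RF) /point_le !leqnn.
move=> q r qP rP; have [FqP Rq] := Fprop _ qP; have [FrP Rr] := Fprop _ rP.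
exact: leR.
Qed.

(** * Counting points and minimal pairs *)

Definition strictly_incr n (lam : nat -> nat) : Prop :=
  (forall i, i < n -> 0 < lam i) /\ (forall i j, i < j < n -> lam i < lam j).

Lemma strictly_incr_lt n lam i j : strictly_incr n lam -> i < j -> j < n -> lam i < lam j.
Proof. by case=> _ incr lt_ij lt_jn; apply: incr; rewrite lt_ij. Qed.

Lemma strictly_incr_le n lam i j : strictly_incr n lam -> i <= j -> j < n -> lam i <= lam j.
Proof. by case=> _ incr le_ij; apply: lam_le. Qed.

Lemma strictly_incr_gap n lam i j : strictly_incr n lam -> i <= j -> j < n ->
  lam i + (j - i) <= lam j.
Proof.
move=> incr_lam; elim: j => [|j IHj] le_ij lt_jn; first by move: le_ij; case: i => //=; lia.
move: le_ij; rewrite leq_eqVlt => /predU1P[-> | lt_ij]; first lia.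
by have := IHj lt_ij (ltnW lt_jn); have := strictly_incr_lt incr_lam (ltnSn j) lt_jn; lia.
Qed.

Lemma sum_geq n i : \sum_(j < n) (i <= j) = n - i.
Proof. by elim: n => [|n IHn]; rewrite ?big_ord0 ?big_ord_recr //= IHn; lia. Qed.

Lemma sum_minn1 n (lam : nat -> nat) : (forall i, i < n -> 0 < lam i) -> \sum_(j < n) minn 1 (lam j) = n.
Proof.
move=> lam_gt0; rewrite (eq_bigr (fun=> 1)) ?sum1_card ?card_ord // => j _.
by have := lam_gt0 j (ltn_ord j); lia.
Qed.

Lemma sum_minnS n (lam : nat -> nat) c : \sum_(j < n) minn c.+1 (lam j)
  = \sum_(j < n) minn c (lam j) + \sum_(j < n) (c < lam j).
Proof. by rewrite -big_split; apply: eq_bigr => j _ /=; case: ltnP; lia. Qed.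

Lemma sum_above_step n lam i : strictly_incr n lam -> i.+1 < n ->
  \sum_(j < n) (lam j - lam i)
    = \sum_(j < n) (lam j - lam i.+1) + (n - i.+1) * (lam i.+1 - lam i).
Proof.
move=> incr_lam lt_in; rewrite -sum_geq big_distrl -big_split; apply: eq_bigr => j _ /=.
have lt_S := strictly_incr_lt incr_lam (ltnSn i) lt_in.
case: (ltnP i j) => [lt_ij | le_ji].
  by have := strictly_incr_le incr_lam lt_ij (ltn_ord j); lia.
by have := strictly_incr_le incr_lam le_ji (ltnW lt_in); lia.
Qed.

(** Equal differences leave only a constant shift, and equal sums remove it. *)
Lemma eq_of_diffs n (lam mu : nat -> nat) : \sum_(i < n) lam i = \sum_(i < n) mu i ->
  (forall i, i.+1 < n -> lam i.+1 + mu i = mu i.+1 + lam i) ->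
  forall i, i < n -> lam i = mu i.
Proof.
move=> eq_sum diff.
have shift i : i < n -> lam i + mu 0 = mu i + lam 0.
  by elim: i => [|i IHi] lt_in; [lia | have := diff i lt_in; have := IHi (ltnW lt_in); lia].
move=> i lt_in; have n_gt0 : 0 < n by lia.
have : \sum_(j < n) (lam j + mu 0) = \sum_(j < n) (mu j + lam 0).
  by apply: eq_bigr => j _; apply: shift.
rewrite !big_split /= eq_sum !sum_nat_const card_ord => /addnI/eqP.
by rewrite eqn_pmul2l // => /eqP eq0; have := shift i lt_in; lia.
Qed.

Lemma size_points n lam : size (points n lam) = \sum_(i < n) lam i.
Proof.
rewrite -count_predT (count_points (t := lam)) => [|j x _ _ ->] //.
by apply: eq_bigr => j _; rewrite minnn.
Qed.

Lemma size_points_iso n lam m mu F E : points_iso n lam m mu F E ->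
  \sum_(i < n) lam i = \sum_(i < m) mu i.
Proof. by move=> isoF; rewrite -!size_points -!count_predT -(count_points_iso _ isoF). Qed.

Lemma belowE n lam i x :
  below n lam (i, x) = \sum_(j < n) minn (minn x (lam j + x - lam i)) (lam j).
Proof.
apply: (count_points (t := fun j => minn x (lam j + x - lam i))) => j y _ y0 _.
by rewrite /point_le /=; lia.
Qed.

Lemma below_row n lam i : strictly_incr n lam -> i < n -> below n lam (i, 1) = n - i.
Proof.
move=> incr_lam lt_in; rewrite belowE // -sum_geq; apply: eq_bigr => j _.
have lam_j := incr_lam.1 j (ltn_ord j); case: leqP => [le_ij | lt_ji].
  by have := strictly_incr_le incr_lam le_ij (ltn_ord j); lia.
by have := strictly_incr_lt incr_lam lt_ji lt_in; lia.
Qed.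

Lemma not_above_row n lam i : not_above n lam (i, 1) = \sum_(j < n) (lam j - lam i).
Proof.
rewrite /not_above (count_points (t := fun j => lam j - lam i)).
  by apply: eq_bigr => j _; lia.
by move=> j x _ x0 _; rewrite /point_le /=; lia.
Qed.

Lemma not_above_top n lam x : strictly_incr n.+1 lam -> 0 < x ->
  not_above n.+1 lam (n, x) = \sum_(j < n.+1) minn x.-1 (lam j).
Proof.
move=> incr_lam x0; apply: (count_points (t := fun=> x.-1)) => j y lt_jn _ _.
have := strictly_incr_le incr_lam (leq_ord (Ordinal lt_jn)) (ltnSn n).
by rewrite /point_le /=; lia.
Qed.

Lemma below_top n lam x : strictly_incr n.+2 lam -> x <= lam n.+1 - lam n ->
  below n.+2 lam (n.+1, x) = x.
Proof.
move=> incr_lam le_x; rewrite belowE // big_ord_recr /= big1 => [|j _]; first lia.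
by have := strictly_incr_le incr_lam (leq_ord j) (ltnW (ltnSn _)); lia.
Qed.

(** The two longest rows interleave as [(n.+2, 1)], [(n.+1, 1)], [(n.+2, 2)], and so on. Up to the
    stated bound no shorter row contributes, so odd positions belong to the longest row and even
    ones to the second. *)
Lemma below_top1 n lam x : strictly_incr n.+3 lam -> lam n.+2 = (lam n.+1).+1 ->
  0 < x -> x <= (lam n.+1 - lam n).+1 -> below n.+3 lam (n.+2, x) = (x + x).-1.
Proof.
move=> incr_lam gap1 x0 le_x; rewrite belowE // !big_ord_recr /= big1 => [|j _].
  have := strictly_incr_lt incr_lam (ltnSn n) (ltnW (ltnSn _)).
  by have := incr_lam.1 n; lia.
have := strictly_incr_lt incr_lam (ltnSn n) (ltnW (ltnSn _)).
by have := strictly_incr_le incr_lam (ltnW (ltn_ord j)); move/(_ ltac:(lia)); lia.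
Qed.

Lemma below_second n lam x : strictly_incr n.+3 lam -> lam n.+2 = (lam n.+1).+1 ->
  x <= lam n.+1 - lam n -> below n.+3 lam (n.+1, x) = x + x.
Proof.
move=> incr_lam gap1 le_x; rewrite belowE // !big_ord_recr /= big1 => [|j _].
  by have := strictly_incr_lt incr_lam (ltnSn n) (ltnW (ltnSn _)); lia.
have := strictly_incr_lt incr_lam (ltnSn n) (ltnW (ltnSn _)).
by have := strictly_incr_le incr_lam (ltnW (ltn_ord j)); move/(_ ltac:(lia)); lia.
Qed.

Lemma not_above_second n lam x : strictly_incr n.+2 lam -> lam n.+1 = (lam n).+1 ->
  0 < x -> x <= lam n ->
  not_above n.+2 lam (n, x) = (\sum_(j < n.+2) minn x.-1 (lam j)).+1.
Proof.
move=> incr_lam gap1 x0 le_x.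
rewrite /not_above (count_points (t := fun j => x.-1 + (j == n.+1))).
  rewrite [LHS]big_ord_recr [in RHS]big_ord_recr /= eqxx -addnS; congr (_ + _); last lia.
  by apply: eq_bigr => j _; rewrite [j == _ :> nat]ltn_eqF // addn0.
move=> j y lt_jn _ _; rewrite /point_le /=.
have [-> | neq_j] := eqVneq j n.+1; first lia.
have le_jn : j <= n by lia.
by have := strictly_incr_le incr_lam le_jn (ltnW (ltnSn _)); lia.
Qed.

(** * Incomparable points and the minimal pair *)

Definition incomparable lam q r := ~~ point_le lam q r && ~~ point_le lam r q.

(* The two points [a], [b] are then the minimal elements of the set of points that are incomparable to some other point. *)
Definition minimal_pair n lam a b : Prop :=
  [/\ a \in points n lam, b \in points n lam, incomparable lam a b &
      forall q r, q \in points n lam -> r \in points n lam -> incomparable lam q r ->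
        point_le lam a q || point_le lam b q].

Lemma point_le_trans lam : transitive (point_le lam).
Proof. by move=> [j y] [i x] [k z]; rewrite /point_le /=; lia. Qed.

(** Members of either pair are incomparable to some point, so each lies above a member of the other
    pair; antisymmetry then matches the pairs. *)
Lemma minimal_pair_uniq n lam a b a' b' : strictly_incr n lam ->
  minimal_pair n lam a b -> minimal_pair n lam a' b' ->
  (a' = a /\ b' = b) \/ (a' = b /\ b' = a).
Proof.
move=> incr_lam [aP bP inc_ab min_ab] [a'P b'P inc_ab' min_ab'].
have anti := point_le_anti incr_lam.2; have tr := @point_le_trans lam.
have sym q r : incomparable lam q r -> incomparable lam r q by rewrite /incomparable andbC.
have /andP[/negP nab /negP nba] := inc_ab; have /andP[/negP nab' /negP nba'] := inc_ab'.
have min_a' := min_ab _ _ a'P b'P inc_ab'; have min_b' := min_ab _ _ b'P a'P (sym _ _ inc_ab').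
have min_a := min_ab' _ _ aP bP inc_ab; have min_b := min_ab' _ _ bP aP (sym _ _ inc_ab).
case/orP: min_a' => [aa' | ba']; [left | right].
- have a'a : point_le lam a' a.
    by case/orP: min_a => // b'a; case: nba'; apply: tr b'a aa'.
  have eqa : a' = a by apply: anti.
  subst a'; split=> //; case/orP: min_b' => // bb'.
  by case/orP: min_b => // b'b; apply: anti.
- have a'b : point_le lam a' b.
    by case/orP: min_b => // b'b; case: nba'; apply: tr b'b ba'.
  have eqa : a' = b by apply: anti.
  subst a'; split=> //; case/orP: min_b' => // ab'.
  by case/orP: min_a => // b'a; apply: anti.
Qed.

Lemma incomparable_iso n lam m mu F E q r : points_iso n lam m mu F E ->
  q \in points n lam -> r \in points n lam ->
  incomparable mu (F q) (F r) = incomparable lam q r.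
Proof. by case=> _ _ leF qP rP; rewrite /incomparable !leF. Qed.

Lemma minimal_pair_iso n lam m mu F E a b : points_iso n lam m mu F E ->
  minimal_pair n lam a b -> minimal_pair m mu (F a) (F b).
Proof.
move=> isoF [aP bP inc_ab min_ab]; have [FP EP leF] := isoF.
split; [by have [] := FP _ aP | by have [] := FP _ bP | | ].
  by rewrite (incomparable_iso isoF).
move=> q r /EP[qP <-] /EP[rP <-]; rewrite (incomparable_iso isoF) // !leF //.
exact: min_ab.
Qed.

(* Two rows whose parameters differ by one form together a single chain, so that the second minimal point is taken in the first row below the top that does not merge with it. *)
Definition second_row k (lam : nat -> nat) : nat :=
  if lam k.+1 == (lam k).+1 then k.-1 else k.

(** For strictly increasing [lam] this says that the poset with [k.+2] rows is not a chain. *)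
Definition unmerged k (lam : nat -> nat) : bool := (0 < k) || (lam k.+1 != (lam k).+1).

(** Points with second coordinate at least 2 lie above [(k.+1, 2)], and first points of rows up to
    [r] lie above [(r, 1)]. What remains is [(k.+1, 1)] and, if the top rows merge, [(k, 1)]; both
    are comparable to every point. *)
Lemma minimal_pairP k lam : strictly_incr k.+2 lam -> unmerged k lam ->
  minimal_pair k.+2 lam (k.+1, 2) (second_row k lam, 1).
Proof.
move=> incr_lam un; set r := second_row k lam.
have le_rk : r <= k by rewrite /r /second_row; case: eqP; lia.
have lam_r : lam r.+1 + 1 <= lam k.+1 \/ r = k /\ lam k + 2 <= lam k.+1.
  have lt_k := strictly_incr_lt incr_lam (ltnSn k) (ltnSn _).
  move: un; rewrite /r /second_row /unmerged; case: eqP => [eq1 | neq1]; last by right; lia.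
  by rewrite orbF => k_gt0; left; rewrite prednK //; lia.
have gap_r : lam r + 2 <= lam k.+1.
  have lt_r := strictly_incr_lt incr_lam (ltnSn r) _.
  case: lam_r => [le_r | [-> //]].
  have : r.+1 < k.+2 by lia. move/lt_r; lia.
have lam_k : 0 < lam r by apply: incr_lam.1; lia.
split; rewrite ?mem_points /=; try lia; first by rewrite /incomparable /point_le /=; lia.
move=> [j x] [i y]; rewrite !mem_points /incomparable /point_le /=.
move=> /and3P[lt_jk x0 le_x] /and3P[lt_ik y0 le_y] inc.
have le_jk : lam j <= lam k.+1 by apply: (strictly_incr_le incr_lam).
have le_ik : lam i <= lam k.+1 by apply: (strictly_incr_le incr_lam).
have [x_gt1 | x_le1] := ltnP 1 x; first by lia.
have [le_jr | lt_rj] := leqP j r.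
  by have := strictly_incr_le incr_lam le_jr; move/(_ ltac:(lia)); lia.
have [eq_j | neq_j] := eqVneq j k.+1; first by subst j; lia.
have merged : lam k.+1 = (lam k).+1 /\ j = k.
  move: lt_rj; rewrite /r /second_row; case: eqP => [-> | _]; lia.
case: merged => mk ej; subst j.
have [eq_i | neq_i] := eqVneq i k.+1; first by subst i; lia.
have le_ik' : i <= k by lia.
by have := strictly_incr_le incr_lam le_ik' (ltnW (ltnSn _)); lia.
Qed.

Definition is_chain n lam : Prop :=
  forall q r, q \in points n lam -> r \in points n lam -> ~~ incomparable lam q r.

Lemma chainP n lam : strictly_incr n lam ->
  is_chain n lam <-> n <= 1 \/ n = 2 /\ lam 1 = (lam 0).+1.
Proof.
move=> incr_lam; split=> [chain | short].
  case: n incr_lam chain => [|[|k]] incr_lam chain; [by left | by left | right].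
  have [un | ] := boolP (unmerged k lam).
    have [aP bP inc _] := minimal_pairP incr_lam un.
    by have := chain _ _ aP bP; rewrite inc.
  by rewrite /unmerged negb_or negbK => /andP[k0 /eqP]; have -> : k = 0 by lia.
move=> [i x] [j y]; rewrite !mem_points /incomparable /point_le /=.
move=> /and3P[lt_in _ _] /and3P[lt_jn _ _].
case: short => [n1 | [n2 gap1]].
  by have [-> ->] : i = 0 /\ j = 0; lia.
have : i = 0 \/ i = 1 by lia.
have : j = 0 \/ j = 1 by lia.
by case=> -> [] ->; rewrite ?gap1; lia.
Qed.

Lemma chain_iso n lam m mu F E : points_iso n lam m mu F E ->
  is_chain n lam -> is_chain m mu.
Proof.
move=> isoF chain q r qP rP; rewrite -(incomparable_iso (points_iso_sym isoF)) //.
by have [_ EP _] := isoF; apply: chain; [case: (EP _ qP) | case: (EP _ rP)].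
Qed.

(** * Rigidity of the poset of points *)

Lemma gap_row_image n lam m mu F E i r : points_iso n lam m.+1 mu F E ->
  i < n -> 0 < lam i -> ~~ point_le mu (r, 1) (F (i, 1)) ->
  exists j x, [/\ F (i, 1) = (j, x), j < m.+1, 0 < x & x + mu r <= mu j].
Proof.
move=> isoF lt_in lam_i; have qP : (i, 1) \in points n lam by rewrite mem_points; lia.
have [FP _ _] := isoF; have [] := FP _ qP; case: (F (i, 1)) => j x.
by rewrite mem_points /point_le /= => FqP _ nle; exists j, x; split=> //; lia.
Qed.

(** The points not above [(n, 2)] are exactly the first points of the rows. Their number gives
    [n = m], and [below] shows that [F] fixes each of them. Comparing [not_above] at consecutive
    rows then yields equal gaps. *)
Lemma straight_eq n lam m mu F E : strictly_incr n.+1 lam -> strictly_incr m.+1 mu ->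
  1 < lam n -> 1 < mu m ->
  points_iso n.+1 lam m.+1 mu F E -> F (n, 2) = (m, 2) ->
  n = m /\ forall i, i < n.+1 -> lam i = mu i.
Proof.
move=> incr_lam incr_mu lam_n mu_m isoF Fn; have [FP _ leF] := isoF.
have topP : (n, 2) \in points n.+1 lam by rewrite mem_points; lia.
have eq_nm : n = m.
  have := not_above_iso isoF topP; rewrite Fn !not_above_top // !sum_minn1 //.
  - by case.
  - exact: incr_lam.1.
  - exact: incr_mu.1.
split=> //; subst m.
have F_row i : i < n.+1 -> F (i, 1) = (i, 1).
  move=> lt_in; have lam_i := incr_lam.1 i lt_in.
  have qP : (i, 1) \in points n.+1 lam by rewrite mem_points; lia.
  have : ~~ point_le mu (F (n, 2)) (F (i, 1)) by rewrite leF // /point_le /=.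
  have := below_iso isoF qP; have [FqP _] := FP _ qP; move: FqP.
  rewrite below_row // Fn; case: (F (i, 1)) => j x; rewrite mem_points /point_le /=.
  move=> /and3P[lt_jn x0 le_x] eq_below nle.
  have := strictly_incr_le incr_mu (_ : j <= n) (ltnSn n).
  move=> /(_ ltac:(lia)) le_j; have x1 : x = 1 by lia.
  by subst x; move: eq_below; rewrite below_row // => eq_ij; congr (_, _); lia.
apply: eq_of_diffs; first exact: size_points_iso isoF.
have eq_above i : i < n.+1 ->
    \sum_(j < n.+1) (lam j - lam i) = \sum_(j < n.+1) (mu j - mu i).
  move=> lt_in; have qP : (i, 1) \in points n.+1 lam.
    by rewrite mem_points; have := incr_lam.1 i lt_in; lia.
  by have := not_above_iso isoF qP; rewrite F_row // !not_above_row.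
move=> i lt_in; have := eq_above i (ltnW lt_in); have := eq_above i.+1 lt_in.
rewrite (sum_above_step incr_lam lt_in) (sum_above_step incr_mu lt_in) => -> /addnI/eqP.
rewrite eqn_pmul2l ?subn_gt0 // => /eqP.
by have := strictly_incr_lt incr_lam (ltnSn i) lt_in; have := strictly_incr_lt incr_mu (ltnSn i) lt_in; lia.
Qed.

(** Row starts are not above [(n.+1, 2)], so their images are not above [(m, 1)] and lie at the
    beginning of the longest row. Counting points below sends [(n.+1 - d, 1)] to [(m.+1, d.+1)]; the
    values of [not_above] there give one equation for each [d]. *)
Lemma crossed_diff n lam m mu F E c : strictly_incr n.+2 lam -> strictly_incr m.+2 mu ->
  points_iso n.+2 lam m.+2 mu F E -> F (n.+1, 2) = (m, 1) -> 1 < lam n.+1 ->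
  c < n.+1 ->
  c.+1 * (lam (n.+1 - c) - lam (n - c)) = \sum_(j < m.+2) (c < mu j).
Proof.
move=> incr_lam incr_mu isoF Fn lam_n.
have topP : (n.+1, 2) \in points n.+2 lam by rewrite mem_points; lia.
have [_ _ leF] := isoF.
have above d : d < n.+2 ->
    \sum_(j < n.+2) (lam j - lam (n.+1 - d)) = \sum_(j < m.+2) minn d (mu j).
  move=> lt_d; set i := n.+1 - d; have lt_i : i < n.+2 by lia.
  have lam_i := incr_lam.1 i lt_i.
  have qP : (i, 1) \in points n.+2 lam by rewrite mem_points; lia.
  have nle : ~~ point_le mu (m, 1) (F (i, 1)) by rewrite -Fn leF // /point_le /=.
  have [j [x [Fi lt_j x0 le_x]]] := gap_row_image isoF lt_i lam_i nle.
  have ej : j = m.+1.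
    have [//|neq_j] := eqVneq j m.+1.
    by have := strictly_incr_le incr_mu (_ : j <= m) (ltnW (ltnSn _)); move/(_ ltac:(lia)); lia.
  subst j; have := below_iso isoF qP; have := not_above_iso isoF qP.
  rewrite Fi below_row // below_top //; last lia.
  rewrite not_above_row not_above_top // => <- ex.
  by apply: eq_bigr => j _; congr minn; lia.
(* The claim is the difference of the equations for [c.+1] and [c]. *)
move=> lt_c; have := above c (ltnW lt_c); have := above c.+1 lt_c.
have e1 : n.+1 - c = (n - c).+1 by lia.
have e2 : n.+1 - c.+1 = n - c by lia.
have e3 : n.+2 - (n - c).+1 = c.+1 by lia.
rewrite e1 e2 sum_minnS (sum_above_step (i := n - c) incr_lam); last lia.
by rewrite e3 => eq1 eq2; move: eq1; rewrite eq2 => /addnI.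
Qed.

Lemma sum_gt_le n (lam : nat -> nat) c : \sum_(j < n) (c < lam j) <= n.
Proof.
rewrite -[leqRHS]card_ord -[leqRHS]sum1_card; apply: leq_sum => j _.
by case: (_ < _).
Qed.

Lemma sum_gt_anti n (lam : nat -> nat) c d : c <= d ->
  \sum_(j < n) (d < lam j) <= \sum_(j < n) (c < lam j).
Proof.
move=> le_cd; apply: leq_sum => j _.
by case: (ltnP d (lam j)) => // /(leq_ltn_trans le_cd) ->.
Qed.

(* [D c] is the gap below the (c+1)-st row from the top; [S c] counts the rows of the other poset with parameter larger than [c]. *)
Lemma crossed_numeric n m (D S : nat -> nat) : 1 < m ->
  (forall c, c.+1 < n -> 0 < D c) -> (forall c, c.+1 < n -> c.+1 * D c = S c) ->
  (forall c, S c <= m) -> (forall c, S c.+1 <= S c) -> m <= n ->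
  S 0 = m ->
  [\/ [/\ n = m, n = 2 & D 0 = 2], [/\ n = m, n = 3, D 0 = 3 & D 1 = 1],
      [/\ n = m, n = 4, D 0 = 4, D 1 = 2 & D 2 = 1] |
      [/\ n = 3, m = 2, D 0 = 2 & D 1 = 1]].
Proof.
move=> m_gt1 D0 DS Sm S_anti le_mn S0.
(* At the last index, [c.+1 * D c = S c <= m] with [D c] positive bounds [n - 1] by [m]; hence [n]
   is [m] or [m + 1]. *)
have last_n c : c.+2 = n -> c.+1 <= m.
  move=> eq_n; have := DS c; have := D0 c; have := Sm c; rewrite -eq_n.
  by move=> le_S /(_ (ltnSn _)) D_gt0 /(_ (ltnSn _)) eq_S; nia.
have le_nm : n <= m.+1 by have := last_n n.-2; lia.
have D0E := DS 0; have D1E := DS 1.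
case: (ltngtP n m) le_mn le_nm => // [lt_mn _ le_nm | eq_nm _ _].
  have eq_n : n = m.+1 by lia.
  have [m_gt2 | m_le2] := ltnP 2 m; last first.
    have em : m = 2 by lia.
    rewrite eq_n em in D0 D0E D1E *; constructor 4.
    by have := D0 1 isT; have := Sm 1; have := D1E isT; have := D0E isT; split=> //; lia.
  (* The last equation forces [S k.+1 = k + 2 = m]. Monotonicity then gives [(k + 1) * D k = k + 2],
     impossible for positive [k]. *)
  have [k ek] : exists k, n = k.+3 by exists (n - 3); lia.
  have em : m = k.+2 by lia.
  move: (D0 k) (D0 k.+1) (DS k) (DS k.+1) (Sm k) (Sm k.+1) (S_anti k).
  rewrite ek em ltnSn ltnW // => /(_ isT) d0 /(_ isT) d1 /(_ isT) <- /(_ isT) <-.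
  by case: (D k) d0 => [|[|d]] //; case: (D k.+1) d1 => [|d'] //; nia.
case: n D0 DS last_n D0E D1E eq_nm => [|[|[|[|[|n]]]]] D0 DS _ D0E D1E eq_nm; try lia.
- by constructor 1; rewrite -eq_nm in S0 Sm *; split=> //; lia.
- constructor 2; rewrite -eq_nm in S0 Sm *; split=> //; first lia.
  by have := D0 1 isT; have := D1E isT; have := Sm 1; lia.
- constructor 3; rewrite -eq_nm in S0 Sm *; split=> //; first lia.
  + have := D0 1 isT; have := D1E isT; have := Sm 1; have := S_anti 1.
    by have := DS 2 isT; have := D0 2 isT; lia.
  + by have := D0 2 isT; have := DS 2 isT; have := Sm 2; lia.
(* Here both lengths are [n + 5]. The last equation forces [S n.+3 = n + 4], so [S n.+2] would be a
   multiple of [n + 3] between [n + 4] and [n + 5]. *)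
exfalso.
have := DS n.+3 (ltnSn _); have := D0 n.+3 (ltnSn _); have := Sm n.+3; have := S_anti n.+2.
have := DS n.+2 (ltnW (ltnSn _)); have := Sm n.+2.
case: (D n.+3) => [|[|d3]]; try by nia.
by case: (D n.+2) => [|[|d2]]; nia.
Qed.

(** If [lam 0] were at least 2, the point [(2, 3)] would be incomparable to the three points
    [(0, 1)], [(0, 2)] and [(1, 2)]. With two rows whose lengths differ by 3, a point is
    incomparable to at most two others. So [lam 0 = 1], and the number of points gives [mu 0]. *)
Lemma exceptional_params n lam m mu F E : strictly_incr n lam -> strictly_incr m mu ->
  points_iso n lam m mu F E -> n = 3 -> m = 2 ->
  lam 1 = (lam 0).+1 -> lam 2 = (lam 1).+2 -> mu 1 = mu 0 + 3 ->
  [/\ lam 0 = 1, lam 1 = 2 & lam 2 = 4] /\ [/\ mu 0 = 2 & mu 1 = 5].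
Proof.
move=> incr_lam incr_mu isoF en em; subst n m => l1 l2 m1.
have eq_size := size_points_iso isoF; move: eq_size; rewrite !big_ord_recl !big_ord0 /= /bump /=.
rewrite ?addn0 ?addn1 /= => eq_size.
have lam0 := incr_lam.1 0 isT.
suff : lam 0 < 2 by split; split; lia.
rewrite ltnNge; apply/negP => lam_ge2; have [FP _ leF] := isoF.
have qP : (2, 3) \in points 3 lam by rewrite mem_points; lia.
have r0P : (0, 1) \in points 3 lam by rewrite mem_points; lia.
have r1P : (0, 2) \in points 3 lam by rewrite mem_points; lia.
have r2P : (1, 2) \in points 3 lam by rewrite mem_points; lia.
have inc r : r \in points 3 lam -> incomparable lam (2, 3) r ->
    incomparable mu (F (2, 3)) (F r).
  by move=> rP; rewrite (incomparable_iso isoF).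
have inc0 := inc _ r0P; have inc1 := inc _ r1P; have inc2 := inc _ r2P.
have [Fq _] := FP _ qP; have [F0 E0] := FP _ r0P; have [F1 E1] := FP _ r1P.
have [F2 E2] := FP _ r2P.
have n01 : F (0, 1) <> F (0, 2) by move=> e; move: E0; rewrite e E1.
have n02 : F (0, 1) <> F (1, 2) by move=> e; move: E0; rewrite e E2.
have n12 : F (0, 2) <> F (1, 2) by move=> e; move: E1; rewrite e E2.
move: inc0 inc1 inc2 Fq F0 F1 F2 n01 n02 n12.
rewrite /incomparable /point_le /=.
case: (F (2, 3)) => [i x]; case: (F (0, 1)) => [i0 x0].
case: (F (0, 2)) => [i1 x1]; case: (F (1, 2)) => [i2 x2] /=.
rewrite !mem_points => inc0 inc1 inc2 iP i0P i1P i2P n01 n02 n12.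
have {}inc0 := inc0 ltac:(lia); have {}inc1 := inc1 ltac:(lia); have {}inc2 := inc2 ltac:(lia).
have s01 : i0 = i1 -> x0 <> x1 by move=> ei ex; apply: n01; rewrite ei ex.
have s02 : i0 = i2 -> x0 <> x2 by move=> ei ex; apply: n02; rewrite ei ex.
have s12 : i1 = i2 -> x1 <> x2 by move=> ei ex; apply: n12; rewrite ei ex.
have two j y : [&& j < 2, 0 < y & y <= mu j] -> j = 0 \/ j = 1 by lia.
case: (two _ _ iP) inc0 inc1 inc2 => -> inc0 inc1 inc2.
  case: (two _ _ i0P) inc0 s01 s02 => ->; case: (two _ _ i1P) inc1 s12 => ->;
    case: (two _ _ i2P) inc2 => ->; rewrite ?m1; lia.
case: (two _ _ i0P) inc0 s01 s02 => ->; case: (two _ _ i1P) inc1 s12 => ->;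
  case: (two _ _ i2P) inc2 => ->; rewrite ?m1; lia.
Qed.

(** Otherwise the row before the one of the second minimal point has a first point with four points
    below it, and its image must be the fourth point [(m.+1, 2)] of the merged rows. Its [not_above]
    exceeds that of [(m.+2, 2)] by 1, while the corresponding difference in [lam] is a positive
    multiple of 3. *)
Lemma crossed_merged_short n lam m mu F E : strictly_incr n.+3 lam -> strictly_incr m.+3 mu ->
  mu m.+2 = (mu m.+1).+1 -> points_iso n.+3 lam m.+3 mu F E ->
  F (n.+2, 2) = (m, 1) -> F (n, 1) = (m.+2, 2) -> n = 0.
Proof.
move=> incr_lam incr_mu gap1 isoF Fn Fr; case: n incr_lam isoF Fn Fr => // n incr_lam isoF Fn Fr.
have lam_gt0 i : i < n.+4 -> 0 < lam i by apply: incr_lam.1.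
have [_ _ leF] := isoF.
have rowP i : i < n.+4 -> (i, 1) \in points n.+4 lam.
  by move=> lt_i; rewrite mem_points; have := lam_gt0 i lt_i; lia.
have lt_n : n < n.+4 by lia.
have lt_n1 : n.+1 < n.+4 by lia.
have gap_top := strictly_incr_gap incr_lam (leq0n n.+3) (ltnSn _).
have topP : (n.+3, 2) \in points n.+4 lam by rewrite mem_points; lia.
have nle : ~~ point_le mu (m, 1) (F (n, 1)).
  by rewrite -Fn leF ?rowP // /point_le.
have [j [x [Fi lt_j x0 le_x]]] := gap_row_image isoF lt_n (lam_gt0 n lt_n) nle.
have := below_iso isoF (rowP n lt_n); rewrite Fi below_row //.
have -> : n.+4 - n = 4 by lia.
have mu_m := strictly_incr_lt incr_mu (ltnSn m) (ltnW (ltnSn _)).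
have cases_j : j = m.+2 \/ j = m.+1.
  have [le_jm | lt_mj] := leqP j m; last by lia.
  by have := strictly_incr_le incr_mu le_jm; move/(_ ltac:(lia)); lia.
case: cases_j => ej; subst j; first by rewrite below_top1 //; lia.
rewrite below_second //; last lia.
move=> ex; have {}ex : x = 2 by lia.
subst x; have := not_above_iso isoF (rowP n lt_n).
have := not_above_iso isoF (rowP n.+1 lt_n1).
rewrite Fi Fr !not_above_row not_above_top // not_above_second //; last lia.
rewrite (sum_above_step incr_lam lt_n1) => <-.
have -> : n.+4 - n.+1 = 3 by lia.
by have := strictly_incr_lt incr_lam (ltnSn n) lt_n1; lia.
Qed.

(** Both minimal points have the same number of points below them: 3 if the top rows merge and 2
    otherwise. A crossed isomorphism therefore requires that both posets merge or neither does. *)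
Lemma below_top_pair k lam : strictly_incr k.+2 lam -> unmerged k lam ->
  below k.+2 lam (k.+1, 2) = k.+2 - second_row k lam.
Proof.
move=> incr_lam; rewrite /unmerged /second_row; case: eqP => [gap1 | ngap _].
  rewrite orbF; case: k incr_lam gap1 => // k incr_lam gap1 _ /=.
  have := strictly_incr_lt incr_lam (ltnSn k) (ltnW (ltnSn _)) => lt_k.
  by rewrite below_top1 //; lia.
have := strictly_incr_lt incr_lam (ltnSn k) (ltnSn _) => lt_k.
by rewrite below_top //; lia.
Qed.

Lemma second_row_lt k lam : strictly_incr k.+2 lam -> second_row k lam < k.+2.
Proof. by rewrite /second_row; case: eqP; lia. Qed.

(** [crossed_diff] applies to [F] and to its inverse, and [crossed_numeric] leaves a short list. For
    equal numbers of rows it allows one gap sequence per number of rows, so the gaps of [lam] and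
    [mu] agree. For unequal numbers it leaves gaps 1 and 2 against a single gap 3. *)
Lemma crossed_unmerged k lam l mu F E : strictly_incr k.+2 lam -> strictly_incr l.+2 mu ->
  l <= k -> points_iso k.+2 lam l.+2 mu F E ->
  F (k.+1, 2) = (l, 1) -> F (k, 1) = (l.+1, 2) ->
  (l.+2 = k.+2 /\ forall i, i < k.+2 -> lam i = mu i) \/
  [/\ k.+2 = 3, l.+2 = 2, [/\ lam 0 = 1, lam 1 = 2 & lam 2 = 4] & [/\ mu 0 = 2 & mu 1 = 5]].
Proof.
move=> incr_lam incr_mu le_lk isoF Fa Fb; have [FP _ _] := isoF.
have isoE := points_iso_sym isoF.
have lam_top : 1 < lam k.+1.
  by have := strictly_incr_lt incr_lam (ltnSn k) (ltnSn _); have := incr_lam.1 k; lia.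
have mu_top : 1 < mu l.+1.
  by have := strictly_incr_lt incr_mu (ltnSn l) (ltnSn _); have := incr_mu.1 l; lia.
have bP : (k, 1) \in points k.+2 lam by rewrite mem_points; have := incr_lam.1 k; lia.
have Ea : E (l.+1, 2) = (k, 1) by rewrite -Fb; case: (FP _ bP).
have diffL c := crossed_diff (c := c) incr_lam incr_mu isoF Fa lam_top.
have diffM c := crossed_diff (c := c) incr_mu incr_lam isoE Ea mu_top.
have gapL c : c < k.+1 -> 0 < lam (k.+1 - c) - lam (k - c).
  by move=> lt_c; rewrite subn_gt0; apply: (strictly_incr_lt incr_lam); lia.
have gapM c : c < l.+1 -> 0 < mu (l.+1 - c) - mu (l - c).
  by move=> lt_c; rewrite subn_gt0; apply: (strictly_incr_lt incr_mu); lia.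
have sum_pos n nu : strictly_incr n nu -> \sum_(j < n) (0 < nu j) = n.
  move=> incr_nu; rewrite -[RHS](sum_minn1 incr_nu.1); apply: eq_bigr => j _.
  by have := incr_nu.1 j (ltn_ord j); lia.
have eq_size := size_points_iso isoF.
have numL := @crossed_numeric k.+2 l.+2 (fun c => lam (k.+1 - c) - lam (k - c))
  (fun c => \sum_(j < l.+2) (c < mu j)) isT gapL diffL (sum_gt_le _ _)
  (fun c => sum_gt_anti _ _ (leqnSn c)) le_lk (sum_pos _ _ incr_mu).
have [eq_kl | neq_kl] := eqVneq k l; last first.
  right; case: numL => [[]|[]|[]|[]]; try lia.
  move=> ek el dl0 dl1; have {}ek : k = 1 by lia.
  have {}el : l = 0 by lia.
  subst k l; have := diffM 0 isT; rewrite sum_pos // mul1n subn0 => dm0.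
  change (lam 1 - lam 0 = 1) in dl1; change (lam 2 - lam 1 = 2) in dl0; change (mu 1 - mu 0 = 3) in dm0.
  have l1 : lam 1 = (lam 0).+1 by lia.
  have l2 : lam 2 = (lam 1).+2 by lia.
  have m1 : mu 1 = mu 0 + 3 by lia.
  by have [] := exceptional_params incr_lam incr_mu isoF erefl erefl l1 l2 m1; split.
left; subst l; split=> //; apply: eq_of_diffs => //.
have numM := @crossed_numeric k.+2 k.+2 (fun c => mu (k.+1 - c) - mu (k - c))
  (fun c => \sum_(j < k.+2) (c < lam j)) isT gapM diffM (sum_gt_le _ _)
  (fun c => sum_gt_anti _ _ (leqnSn c)) (leqnn _) (sum_pos _ _ incr_lam).
have gaps i : i.+1 < k.+2 -> lam i.+1 - lam i = mu i.+1 - mu i.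
  case: numL numM => [[_ ek d0]|[_ ek d0 d1]|[_ ek d0 d1 d2]|[ek ek' _ _]]; last lia.
  - case: ek => ek; subst k; case=> [[_ // _ e0]|[_ // _ e0 e1]|[_ // _ e0 e1 e2]|[//]].
    by case: i => // _; rewrite d0 e0.
  - case: ek => ek; subst k; case=> [[_ // _ e0]|[_ // _ e0 e1]|[_ // _ e0 e1 e2]|[//]].
    by case: i => [|[|i]] // _; [rewrite [LHS]d1 [RHS]e1 | rewrite [LHS]d0 [RHS]e0].
  - case: ek => ek; subst k; case=> [[_ // _ e0]|[_ // _ e0 e1]|[_ // _ e0 e1 e2]|[//]].
    by case: i => [|[|[|i]]] // _; [rewrite [LHS]d2 [RHS]e2 | rewrite [LHS]d1 [RHS]e1 | rewrite [LHS]d0 [RHS]e0].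
move=> i lt_i; have := gaps i lt_i.
by have := strictly_incr_lt incr_lam (ltnSn i) lt_i; have := strictly_incr_lt incr_mu (ltnSn i) lt_i; lia.
Qed.

(** * Classification of isomorphic posets of points *)

Definition exceptional_pair n (lam : nat -> nat) m (mu : nat -> nat) : Prop :=
  [\/ m = n /\ (forall i, i < n -> lam i = mu i),
      (exists2 k, 1 <= k &
        [/\ n = 2, lam 0 = k, lam 1 = k.+1, m = 1 & mu 0 = (2 * k).+1])
    | [/\ n = 3, m = 2, [/\ lam 0 = 1, lam 1 = 2 & lam 2 = 4] & [/\ mu 0 = 2 & mu 1 = 5]]].

Lemma chain_classification n lam m mu : strictly_incr n lam -> strictly_incr m mu ->
  m <= n -> \sum_(i < n) lam i = \sum_(i < m) mu i ->
  n <= 1 \/ n = 2 /\ lam 1 = (lam 0).+1 -> m <= 1 \/ m = 2 /\ mu 1 = (mu 0).+1 ->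
  exceptional_pair n lam m mu.
Proof.
move=> incr_lam incr_mu le_mn eq_size shortL shortM.
have lam_gt0 := incr_lam.1 0.
case: n m le_mn eq_size shortL shortM incr_lam incr_mu lam_gt0 => [|[|[|n]]] [|[|[|m]]] //;
  rewrite ?big_ord_recl ?big_ord0 /= /bump /= ?addn0 => _ eq_size shortL shortM incr_lam incr_mu lam_gt0;
  try lia.
- by constructor 1.
- by constructor 1; split=> // [[]].
- constructor 2; exists (lam 0); [lia | split=> //; lia].
- by constructor 1; split=> // [[|[|]]] // _; lia.
Qed.

Lemma merged_classification k lam l mu F E : strictly_incr k.+3 lam -> strictly_incr l.+3 mu ->
  lam k.+2 = (lam k.+1).+1 -> mu l.+2 = (mu l.+1).+1 ->
  points_iso k.+3 lam l.+3 mu F E ->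
  F (k.+2, 2) = (l, 1) -> F (k, 1) = (l.+2, 2) ->
  l.+3 = k.+3 /\ forall i, i < k.+3 -> lam i = mu i.
Proof.
move=> incr_lam incr_mu gapL gapM isoF Fa Fb; have isoE := points_iso_sym isoF.
have [FP _ _] := isoF.
have aP : (k.+2, 2) \in points k.+3 lam.
  by rewrite mem_points; have := strictly_incr_gap incr_lam (leq0n k.+2) (ltnSn _); lia.
have bP : (k, 1) \in points k.+3 lam.
  by rewrite mem_points; have := incr_lam.1 k; lia.
have Ea : E (l.+2, 2) = (k, 1) by rewrite -Fb; case: (FP _ bP).
have Eb : E (l, 1) = (k.+2, 2) by rewrite -Fa; case: (FP _ aP).
have k0 := crossed_merged_short incr_lam incr_mu gapM isoF Fa Fb.
have l0 := crossed_merged_short incr_mu incr_lam gapL isoE Ea Eb.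
subst k l; split=> //.
(* Three rows remain on each side. Both counts equal 3, which together with the top gap 1 forces the
   lower gap to be 1 for [lam] and for [mu]. *)
have := not_above_iso isoF bP; have := not_above_iso isoF aP.
rewrite Fa Fb !not_above_row !not_above_top // !sum_minn1; try exact: incr_lam.1; try exact: incr_mu.1.
rewrite !big_ord_recl !big_ord0 /= /bump /= => eqM eqL.
apply: eq_of_diffs; first exact: size_points_iso isoF.
have := strictly_incr_lt incr_lam (ltnSn 0) isT; have := strictly_incr_lt incr_mu (ltnSn 0) isT.
move: eqM eqL; rewrite -[1 + 0]/1 -[1 + 1]/2 => eqM eqL lt_mu lt_lam.
by case=> [|[|]] // _; lia.
Qed.

Lemma points_iso_classification n lam m mu F E : strictly_incr n lam -> strictly_incr m mu ->
  m <= n -> points_iso n lam m mu F E -> exceptional_pair n lam m mu.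
Proof.
move=> incr_lam incr_mu le_mn isoF; have isoE := points_iso_sym isoF.
have eq_size := size_points_iso isoF.
have shortE : (n <= 1 \/ n = 2 /\ lam 1 = (lam 0).+1) <-> (m <= 1 \/ m = 2 /\ mu 1 = (mu 0).+1).
  by split=> short; apply/chainP => //; [apply: (chain_iso isoF) | apply: (chain_iso isoE)];
    apply/chainP.
have unmergedE k nu : ~ (k.+2 <= 1 \/ k.+2 = 2 /\ nu 1 = (nu 0).+1) -> unmerged k nu.
  rewrite /unmerged => long; case: k long => //= long; apply/eqP => gap1; apply: long; right.
  by split.
have [short | long] : (n <= 1 \/ n = 2 /\ lam 1 = (lam 0).+1) \/
                      ~ (n <= 1 \/ n = 2 /\ lam 1 = (lam 0).+1) by lia.
  by apply: chain_classification => //; apply/shortE.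
have longM : ~ (m <= 1 \/ m = 2 /\ mu 1 = (mu 0).+1) by move/shortE.
case: n m incr_lam incr_mu le_mn isoF isoE eq_size long longM {shortE} =>
  [|[|k]] [|[|l]] incr_lam incr_mu le_mn isoF isoE eq_size long longM; try by [case: long; left | case: longM; left].
have unL := unmergedE _ _ long; have unM := unmergedE _ _ longM.
have topL : 1 < lam k.+1 by have := strictly_incr_gap incr_lam (leq0n k.+1) (ltnSn _); have := incr_lam.1 0 isT; lia.
have topM : 1 < mu l.+1 by have := strictly_incr_gap incr_mu (leq0n l.+1) (ltnSn _); have := incr_mu.1 0 isT; lia.
have pairL := minimal_pairP incr_lam unL; have pairM := minimal_pairP incr_mu unM.
have [aP bP _ _] := pairL.
case: (minimal_pair_uniq incr_mu pairM (minimal_pair_iso isoF pairL)) => [[Fa _] | [Fa Fb]].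
  have [[ekl] eq_lm] := straight_eq incr_lam incr_mu topL topM isoF Fa.
  by constructor 1; subst l.
(* Comparing the numbers of points below excludes that exactly one of the two posets has merged top
   rows. *)
have eq_off : k.+2 - second_row k lam = l.+2 - second_row l mu.
  rewrite -below_top_pair // -(below_iso isoF aP) Fa below_row //.
  exact: second_row_lt.
move: unL unM eq_off Fa Fb; rewrite /unmerged /second_row.
case: eqP => [gapL | _]; case: eqP => [gapM | _] /=; rewrite ?orbF ?orbT => k0 l0 eq_off Fa Fb; try lia.
  case: k k0 incr_lam gapL isoF Fa Fb {le_mn isoE eq_size long topL pairL aP bP eq_off} => // k _ incr_lam gapL isoF.
  case: l l0 incr_mu gapM isoF {longM topM pairM} => // l _ incr_mu gapM isoF /= Fa Fb.
  by constructor 1; apply: (merged_classification (F := F) (E := E)).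
case: (crossed_unmerged incr_lam incr_mu le_mn isoF Fa Fb) => [res | res].
  by constructor 1.
by constructor 3.
Qed.

(** * Explicit isomorphisms in the listed cases *)

Lemma canonical_iso_eq n lam mu : (forall i, i < n -> lam i = mu i) ->
  canonical_iso n lam n mu.
Proof.
move=> eq_lm.
have can_eq nu nu' a : (forall i, i < n -> nu i = nu' i) -> canonical n nu a -> canonical n nu' a.
  move=> eq_nu [le_a can_a]; split=> [i lt_in | i j lt_ij lt_jn]; rewrite -?eq_nu //.
  - exact: le_a.
  - exact: can_a.
  - exact: ltn_trans lt_ij lt_jn.
exists id; split=> // [a | b can_b]; first exact: can_eq.
by exists b => //; apply: can_eq can_b => i lt_in; rewrite eq_lm.
Qed.

(** Canonical tuples satisfy [a 0 <= a 1 <= a 0 + 1], so they form a chain indexed by [a 0 + a 1];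
    the inverse splits a number into its rounded halves. *)
Lemma canonical_iso_chain lam mu k : lam 0 = k -> lam 1 = k.+1 -> mu 0 = (2 * k).+1 ->
  canonical_iso 2 lam 1 mu.
Proof.
move=> l0 l1 m0; exists (fun a _ => a 0 + a 1); split.
- move=> a [le_a _]; split=> [[|i] // _ | [|i] [|j]] //.
  by have := le_a 0 isT; have := le_a 1 isT; lia.
- move=> a b [_ /(_ 0 1 isT isT) can_a] [_ /(_ 0 1 isT isT) can_b].
  by rewrite /le_upto /= !andbT; lia.
- move=> b [/(_ 0 isT) le_b _].
  exists (fun i => if i is 0 then (b 0)./2 else uphalf (b 0)).
    by split=> [[|[|i]] // _ | [|i] [|[|j]] // _ _] /=; lia.
  by case=> //= _; lia.
Qed.

(* [a 0], [a 1], [a 2] count the chosen points in rows of lengths 1, 2, 4. The rows of lengths 1 and 2 form one chain; with the end points of the row of length 4 it becomes the row of length 5, and the two middle points of the row of length 4 become the row of length 2. *)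
Lemma canonical_iso_exceptional lam mu : lam 0 = 1 -> lam 1 = 2 -> lam 2 = 4 ->
  mu 0 = 2 -> mu 1 = 5 -> canonical_iso 3 lam 2 mu.
Proof.
move=> l0 l1 l2 m0 m1.
exists (fun a i => if i is 0 then minn 2 (a 2 - 1)
                   else a 0 + a 1 + (0 < a 2) + (3 < a 2)).
have bounds a : canonical 3 lam a ->
    [/\ a 0 <= 1, a 0 <= a 1 <= (a 0).+1 & a 1 <= a 2 <= (a 1).+2].
  move=> [le_a can_a]; have := le_a 0 isT; have := can_a 0 1 isT isT; have := can_a 1 2 isT isT.
  by rewrite l0 l1 l2 => ? ? ?; split; lia.
split.
- move=> a /bounds[? ? ?]; split=> [[|[|i]] // _ | [|i] [|[|j]] // _ _]; lia.
- move=> a b /bounds[? ? ?] /bounds[? ? ?]; rewrite /le_upto /= !andbT.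
  by lia.
- move=> b [le_b can_b]; have := le_b 0 isT; have := can_b 0 1 isT isT; rewrite m0 m1 => b1 b0.
  (* In order, the row of length 5 consists of the first point of the row of length 4, then points
     of the rows of lengths 2, 1 and 2, then the last point of the row of length 4. Each threshold
     on [b 1] tests one of them. *)
  exists (fun i => match i with
    | 0 => (2 < b 1) : nat
    | 1 => (1 < b 1) + (3 < b 1)
    | _ => b 0 + (0 < b 1) + (4 < b 1) end).
    split=> [[|[|[|i]]] // _ | [|[|i]] [|[|[|j]]] // _ _] /=; lia.
  by case=> [|[|i]] // _ /=; lia.
Qed.

Theorem mainTheorem1 (gT rT : finGroupType) (G : {group gT}) (H : {group rT})
    (p n m : nat) (lam mu : nat -> nat) :
  prime p -> p != 2 ->
  (forall i, i < n -> 0 < lam i) -> (forall i j, i < j < n -> lam i < lam j) ->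
  (forall i, i < m -> 0 < mu i) -> (forall i j, i < j < m -> mu i < mu j) ->
  m <= n ->
  cyc_pprod G p n lam -> cyc_pprod H p m mu ->
  (char_lattice_iso G H <->
   [\/ m = n /\ (forall i, i < n -> lam i = mu i),
       (exists2 k, 1 <= k &
         [/\ n = 2, lam 0 = k, lam 1 = k.+1, m = 1 & mu 0 = (2 * k).+1])
     | [/\ n = 3, m = 2, [/\ lam 0 = 1, lam 1 = 2 & lam 2 = 4] & [/\ mu 0 = 2 & mu 1 = 5]]]).
Proof.
move=> p_pr p_odd lam_gt0 lam_incr mu_gt0 mu_incr le_mn prodG prodH.
rewrite (char_lattice_iso_canonical p_pr p_odd lam_gt0 lam_incr mu_gt0 mu_incr prodG prodH).
split=> [iso | ].
  have [F [E isoF]] := canonical_iso_points lam_incr mu_incr iso.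
  exact: (points_iso_classification (conj lam_gt0 lam_incr) (conj mu_gt0 mu_incr) le_mn isoF).
case=> [[-> eq_lm] | [k _ [-> l0 l1 -> m0]] | [-> -> [l0 l1 l2] [m0 m1]]].
- exact: canonical_iso_eq.
- exact: canonical_iso_chain l0 l1 m0.
- exact: canonical_iso_exceptional.
Qed.
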